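(* Let $d\ge 2$, $1\le i\le d-1$, $q\ge 2$ an integer, $p\in[0,1]$, and $p^*=\frac{(1-p)q}{(1-p)q+p}$. Let $r$ be a box in $\mathbb{Z}^d$ and let $\xi$ be any set of $i$-plaquettes of $\mathbb{Z}^d$ (boundary conditions). For each $i$-dimensional percolation subcomplex $P$ of $r$ let $Q$ be its dual complex, a $(d-i)$-dimensional percolation subcomplex of $\overline{r^{\bullet}}$, and let $\xi^{\bullet}$ be the set of $(d-i)$-plaquettes of $(\mathbb{Z}^d)^{\bullet}$ that are dual to $i$-plaquettes of $\mathbb{Z}^d$ not belonging to $\xi$. Then for every $P$, $$\mu^{\xi}_{r,p,q,i}(P)=\mu^{\overline{\xi^{\bullet}}}_{\overline{r^{\bullet}},p^*,q,d-i}(Q).$$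
   Context: $\mathbb{Z}^d$ denotes the cubical complex on $\mathbb{R}^d$ whose $k$-cells are the $k$-dimensional unit cubes with integer corner points. For a subcomplex $X$, $X^{(k)}$ is the union of its cells of dimension at most $k$; $|X^{(i)}|$ denotes the number of $i$-cells ($i$-plaquettes) of $X$. An $i$-dimensional percolation subcomplex $P$ of $X$ is a subcomplex with $X^{(i-1)}\subset P\subset X^{(i)}$; $|P|$ is its number of $i$-plaquettes. A plaquette is open if it belongs to $P$ and closed otherwise. Boxes: for integers $a_k<b_k$, the box $r=\prod_{k=1}^d[a_k,b_k]$, viewed as a complex (for the given $i$), is the union of all cells of dimension at most $i-1$ contained in it and the $i$-cells contained in it that meet its interior (the $i$-cells contained in the boundary are excluded). Dual complex: $(\mathbb{Z}^d)^{\bullet}=\mathbb{Z}^d+(1/2,\dots,1/2)$. Each $i$-cell of $\mathbb{Z}^d$ meets exactly one $(d-i)$-cell of $(\mathbb{Z}^d)^{\bullet}$, called its dual. $\overline{r^{\bullet}}$ is the union of all cells of $(\mathbb{Z}^d)^{\bullet}$ of dimension at most $d-i$ contained in $\prod_k[a_k+\frac12,b_k-\frac12]$; its $(d-i)$-cells are exactly the duals of the $i$-plaquettes of $r$. The dual complex $Q$ of $P\subset r$ is the percolation subcomplex of $\overline{r^{\bullet}}$ whose $(d-i)$-plaquettes are the duals of the $i$-plaquettes of $r$ not in $P$. Measures with boundary conditions: for a finite subcomplex $X$ of $\mathbb{Z}^d$ and a set $\xi$ of $i$-plaquettes, put $P_\xi=P\cup\{\text{plaquettes of }\xi\text{ not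 in }X\}\cup(\mathbb{Z}^d)^{(i-1)}$ and let $\phi:P\to P_\xi$ be the inclusion. Let $\phi^*:H^{i-1}(P_\xi;\mathbb{Z}_q)\to H^{i-1}(P;\mathbb{Z}_q)$ be the induced map, $\mathbb{Z}_q=\mathbb{Z}/q\mathbb{Z}$. Then $\mu^{\xi}_{X,p,q,i}$ is the probability measure on $i$-dimensional percolation subcomplexes $P$ of $X$ with $$\mu^{\xi}_{X,p,q,i}(P)\propto p^{|P|}(1-p)^{|X^{(i)}|-|P|}\,|\mathrm{im}\,\phi^*|.$$ Borel--Moore homology $H_k^{\mathrm{BM}}(X;\mathbb{Z}_q)$ is the homology of the complex of locally finite chains: $C_k^{\mathrm{BM}}(X;\mathbb{Z}_q)$ consists of all formal, possibly infinite, sums $\sum_\sigma a_\sigma\sigma$ over $k$-cells of $X$, with the usual boundary operator extended linearly. With $\phi_*^{\mathrm{BM}}:H_{i-1}^{\mathrm{BM}}(P;\mathbb{Z}_q)\to H_{i-1}^{\mathrm{BM}}(P_\xi;\mathbb{Z}_q)$ induced by $\phi$, the measure $\mu^{\overline{\xi}}_{X,p,q,i}$ (''wired at infinity'') is $$\mu^{\overline{\xi}}_{X,p,q,i}(P)\propto p^{|P|}(1-p)^{|X^{(i)}|-|P|}\,|\mathrm{im}\,\phi_*^{\mathrm{BM}}|.$$ The same definitions apply with $\mathbb{Z}^d$ replaced by $(\mathbb{Z}^d)^{\bullet}$ and $i$ by $d-i$. *)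

(* Defs.v *)
(* MathComp / MathComp-Analysis. *)
From mathcomp Require Import all_boot all_order all_algebra finmap.
From mathcomp Require Import all_classical all_reals.

Set Implicit Arguments.
Unset Strict Implicit.
Unset Printing Implicit Defensive.

Import Order.TTheory GRing.Theory Num.Theory.

Local Open Scope classical_set_scope.
Local Open Scope ring_scope.

(* The cell (x, S) is the unit cube with lower corner x and edge directions S.
   The same type indexes the cells of Z^d and those of the dual complex
   Z^d + (1/2, ..., 1/2); the pair is then read with the offset h = 0,
   respectively h = 1/2 (see [cube]). *)
Definition cell (d : nat) : Type := ('rV[int]_d * {set 'I_d})%type.

Definition cdim d (s : cell d) : nat := #|s.2|.

Definition cube (R : realType) d (h : R) (s : cell d) : set 'rV[R]_d :=
  [set y | forall k, (s.1 0 k)%:~R + h <= y 0 k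
                     <= (s.1 0 k)%:~R + h + (k \in s.2)%:R].

(* Translating both cubes by the same offset does not affect inclusion, so
   offset 0 also gives the faces of the cells of the dual complex. *)
Definition face (R : realType) d (t s : cell d) : Prop :=
  cube (0 : R) t `<=` cube 0 s.

(* A union of cells is represented by the set of all cells contained in it. *)
Definition subcomplex (R : realType) d (X : set (cell d)) : Prop :=
  forall s t, X s -> face R t s -> X t.

Definition skeleton d (X : set (cell d)) (k : nat) : set (cell d) :=
  [set s | X s /\ (cdim s <= k)%N].

Definition plaquettes d (X : set (cell d)) (k : nat) : set (cell d) :=
  [set s | X s /\ cdim s = k].

Definition nplaquettes d (X : set (cell d)) (k : nat) : nat :=
  #|` fset_set (plaquettes X k)|.

Definition percolation (R : realType) d (X : set (cell d)) (i : nat)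
    (P : set (cell d)) : Prop :=
  [/\ subcomplex R P, skeleton X i.-1 `<=` P & P `<=` skeleton X i].

Section Homology.
Variables (q d : nat).

(* The coefficient of t in the cellular boundary of s. *)
Definition bcoef (s t : cell d) : 'Z_q :=
  \sum_(k in s.2) (-1) ^+ #|[pred j in s.2 | (j < k)%N]| *
    ((t == (s.1 + delta_mx 0 k, s.2 :\ k))%:R - (t == (s.1, s.2 :\ k))%:R).

(* Functions on the k-cells of X, extended by 0 to all cells.  There is no
   finiteness condition: these are at the same time the k-cochains of X and its
   locally finite k-chains (any family of cells of Z^d is locally finite). *)
Definition chains (X : set (cell d)) (k : nat) : set (cell d -> 'Z_q) :=
  [set f | forall s, f s != 0 -> plaquettes X k s].

(* In both operators below the sum over all cells has only finitely many
   nonzero terms. *)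
Definition boundary (f : cell d -> 'Z_q) : cell d -> 'Z_q :=
  fun t => \sum_(s \in [set: cell d]) f s * bcoef s t.

Definition coboundary (X : set (cell d)) (f : cell d -> 'Z_q) :
    cell d -> 'Z_q :=
  fun s => if s \in X then \sum_(t \in [set: cell d]) f t * bcoef s t else 0.

Definition restriction (Y : set (cell d)) (f : cell d -> 'Z_q) :
    cell d -> 'Z_q :=
  fun s => if s \in Y then f s else 0.

Definition cocycles (X : set (cell d)) (k : nat) : set (cell d -> 'Z_q) :=
  [set f | chains X k f /\ coboundary X f = 0].

Definition coboundaries (X : set (cell d)) (k : nat) : set (cell d -> 'Z_q) :=
  if k is j.+1 then coboundary X @` chains X j else [set 0].

Definition BM_cycles (X : set (cell d)) (k : nat) : set (cell d -> 'Z_q) :=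
  [set f | chains X k f /\ boundary f = 0].

Definition BM_boundaries (X : set (cell d)) (k : nat) :
    set (cell d -> 'Z_q) :=
  boundary @` chains X k.+1.

Definition add_coset (B : set (cell d -> 'Z_q)) (z : cell d -> 'Z_q) :
    set (cell d -> 'Z_q) :=
  [set z + b | b in B].

(* The underlying set of the quotient group Z / B. *)
Definition quotient_set (Z B : set (cell d -> 'Z_q)) :
    set (set (cell d -> 'Z_q)) :=
  add_coset B @` Z.

(* The map Z / B -> Z' / B' induced by a homomorphism f with f(Z) <= Z' and
   f(B) <= B': it sends z + B to f(z) + B'. *)
Definition induced (B' : set (cell d -> 'Z_q))
    (f : (cell d -> 'Z_q) -> (cell d -> 'Z_q)) (A : set (cell d -> 'Z_q)) :
    set (cell d -> 'Z_q) :=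
  \bigcup_(z in A) add_coset B' (f z).

Lemma induced_add_coset (B B' : set (cell d -> 'Z_q)) f z :
  {morph f : x y / x + y} -> f @` B `<=` B' -> B 0 ->
  (forall x y, B' x -> B' y -> B' (x + y)) ->
  induced B' f (add_coset B z) = add_coset B' (f z).
Proof.
move=> fD fB B0 addB'; apply/seteqP; split => [_ [_ [b Bb <-] [c B'c <-]]|].
  by exists (f b + c); [apply: addB' => //; apply: fB; exists b | rewrite fD addrA].
by move=> _ [c B'c <-]; exists z; [exists 0; rewrite ?addr0 | exists c].
Qed.

Definition cohomology (X : set (cell d)) (k : nat) :=
  quotient_set (cocycles X k) (coboundaries X k).

Definition BM_homology (X : set (cell d)) (k : nat) :=
  quotient_set (BM_cycles X k) (BM_boundaries X k).

(* For Y a subcomplex of X, the number of elements of the image of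
   H^k(X; Z_q) -> H^k(Y; Z_q).  Since [fset_set] is empty on infinite sets, this
   and the next number are meaningful only when Y is finite, as it is below. *)
Definition card_im_cohomology (Y X : set (cell d)) (k : nat) : nat :=
  #|` fset_set (induced (coboundaries Y k) (restriction Y) @` cohomology X k)|.

(* For Y a subcomplex of X, the number of elements of the image of
   H_k^BM(Y; Z_q) -> H_k^BM(X; Z_q); on chains extended by 0 the map induced by
   the inclusion is the identity. *)
Definition card_im_BM (Y X : set (cell d)) (k : nat) : nat :=
  #|` fset_set (induced (BM_boundaries X k) id @` BM_homology Y k)|.

End Homology.

(* P with boundary conditions xi: the plaquettes of xi outside X and the whole
   (i-1)-skeleton of the lattice are added. *)
Definition with_bc d (X : set (cell d)) (i : nat) (xi P : set (cell d)) :
    set (cell d) :=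
  P `|` (xi `\` X) `|` skeleton [set: cell d] i.-1.

Section Measures.
Variables (R : realType) (d : nat).

Definition weight (X : set (cell d)) (p : R) (i : nat)
    (F : set (cell d) -> nat) (P : set (cell d)) : R :=
  p ^+ nplaquettes P i * (1 - p) ^+ (nplaquettes X i - nplaquettes P i)
    * (F P)%:R.

(* The probability of P under the measure on the (finitely many) percolation
   subcomplexes of X that is proportional to [weight]. *)
Definition normalized (X : set (cell d)) (p : R) (i : nat)
    (F : set (cell d) -> nat) (P : set (cell d)) : R :=
  weight X p i F P /
  \sum_(P' \in [set P' | percolation R X i P']) weight X p i F P'.

Definition mu (xi X : set (cell d)) (p : R) (q i : nat) (P : set (cell d)) : R :=
  normalized X p i
    (fun P' => card_im_cohomology q P' (with_bc X i xi P') i.-1) P.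

Definition mu_wired (xi X : set (cell d)) (p : R) (q i : nat)
    (P : set (cell d)) : R :=
  normalized X p i
    (fun P' => card_im_BM q P' (with_bc X i xi P') i.-1) P.

Definition cbox (a b : 'rV[int]_d) (h : R) : set 'rV[R]_d :=
  [set y | forall k, (a 0 k)%:~R + h <= y 0 k <= (b 0 k)%:~R - h].

Definition obox (a b : 'rV[int]_d) : set 'rV[R]_d :=
  [set y | forall k, (a 0 k)%:~R < y 0 k < (b 0 k)%:~R].

Definition box (a b : 'rV[int]_d) (i : nat) : set (cell d) :=
  [set s | cube 0 s `<=` cbox a b 0 /\
    ((cdim s <= i.-1)%N \/ cdim s = i /\ cube 0 s `&` obox a b !=set0)].

(* The closed dual box, as a set of cells of the dual complex. *)
Definition dual_box (a b : 'rV[int]_d) (i : nat) : set (cell d) :=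
  [set t | cube (2^-1 : R) t `<=` cbox a b 2^-1 /\ (cdim t <= d - i)%N].

(* t, a cell of the dual complex, is the dual of s, a cell of Z^d. *)
Definition is_dual (s t : cell d) : Prop :=
  cdim t = (d - cdim s)%N /\ cube (0 : R) s `&` cube 2^-1 t !=set0.

(* Duals of the i-plaquettes of X that are not in A. *)
Definition dual_plaquettes (X : set (cell d)) (i : nat) (A : set (cell d)) :
    set (cell d) :=
  [set t | exists s, [/\ plaquettes X i s, ~ A s & is_dual s t]].

Definition dual_complex (a b : 'rV[int]_d) (i : nat) (P : set (cell d)) :
    set (cell d) :=
  skeleton (dual_box a b i) (d - i).-1 `|` dual_plaquettes (box a b i) i P.

Definition dual_param (q : nat) (p : R) : R :=
  (1 - p) * q%:R / ((1 - p) * q%:R + p).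

End Measures.

(* Main.v *)
(* Let cobound be the cellular coboundary on all of Z^d and write i = n + 1.  Counting
   cosets, the image of H^(i-1)(P_xi) -> H^(i-1)(P) has |Z(P)| / |E| elements, where
   Z(P) is the set of restrictions to the box of (i-1)-cocycles of P_xi and E does
   not depend on P.  Sending a cell to its dual turns the boundary of locally finite
   chains into cobound, and the image of H_(d-i-1)^BM(Q) -> H_(d-i-1)^BM(Q_xi) has
   |C| / |B(P)| elements, where C does not depend on P and B(P) is the set of
   coboundaries cobound g of i-cochains g that vanish on P_xi such that cobound g is
   supported on cells meeting the interior of the box.  So it suffices that
   |Z(P)| |B(P)| q^|P| does not depend on P.

   Open one more plaquette e, and let V be the subgroup of Z_q of the values at e of
   cobound f, for f an (i-1)-cocycle of P_xi.  Evaluation of cobound at e gives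
   |Z(P)| = |V| |Z(P + e)|.  The group B(P) / B(P + e) is cyclic, generated by cobound of
   the indicator of e, and c times this generator is zero iff c = g(e) for a cocycle
   g vanishing on P_xi.  By the Poincare lemma for cochains without finiteness conditions of
   Z^d, such a g is cobound f with f a cocycle of P_xi, so c is in V and
   |B(P)| |V| = q |B(P + e)|. *)

Require Import Defs.
From mathcomp Require Import all_boot all_order all_algebra finmap.
From mathcomp Require Import all_classical all_reals.
From mathcomp Require Import zify ring lra.
Import Order.TTheory GRing.Theory Num.Theory.
Local Open Scope classical_set_scope.
Local Open Scope ring_scope.

Set Implicit Arguments.
Unset Strict Implicit.
Unset Printing Implicit Defensive.

(** * Cochains on all cells of the lattice and their coboundary *)

Section CellularCochains.
Variables (d q : nat).
Implicit Types (f g : cell d -> 'Z_q) (s t : cell d) (S : {set 'I_d}).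

Definition coface_sign S (k : 'I_d) : 'Z_q :=
  (-1) ^+ #|[pred j in S | (j < k)%N]|.

Definition front s k : cell d := (s.1 + delta_mx 0 k, s.2 :\ k).
Definition back s k : cell d := (s.1, s.2 :\ k).

Definition cobound f : cell d -> 'Z_q :=
  fun s => \sum_(k in s.2) coface_sign s.2 k * (f (front s k) - f (back s k)).

Definition dim_supp (n : nat) f := forall s, f s != 0 -> cdim s = n.

(** Only the cells [u k] and [v k] contribute, so the sum over all cells reduces to a finite list
    and can be exchanged with the sum over [k]. Faces of a cell give [coboundaryE], cofaces give
    [boundaryE]. *)
Lemma fsum_finite_combination (I : finType) (A : pred I) (c : I -> 'Z_q)
    (u v : I -> cell d) f :
  \sum_(t \in [set: cell d])
     f t * (\sum_(k | A k) c k * ((t == u k)%:R - (t == v k)%:R)) =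
  \sum_(k | A k) c k * (f (u k) - f (v k)).
Proof.
pose r := undup (codom u ++ codom v).
have mu k : u k \in r by rewrite mem_undup mem_cat codom_f.
have mv k : v k \in r by rewrite mem_undup mem_cat codom_f orbT.
rewrite -(@fsbig_widen _ _ _ _ [set` r]) //; last first.
  move=> t [_ /= /negP tr]; rewrite big1 ?mulr0// => k _.
  have /negPf-> : t != u k by apply: contraNneq tr => ->.
  have /negPf-> : t != v k by apply: contraNneq tr => ->.
  by rewrite subr0 mulr0.
rewrite -fsbig_seq ?undup_uniq //.
under eq_bigr do rewrite mulr_sumr.
rewrite exchange_big /=; apply: eq_bigr => k _.
have E w : w \in r -> \sum_(t <- r) f t * (t == w)%:R = f w.
  move=> wr; rewrite (bigD1_seq w) ?undup_uniq //= eqxx mulr1 big1 ?addr0 //.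
  by move=> t /negPf ->; rewrite mulr0.
under eq_bigr => t _ do rewrite mulrCA mulrBr.
by rewrite -mulr_sumr sumrB !E.
Qed.

Lemma coboundaryE X f s :
  coboundary X f s = if s \in X then cobound f s else 0.
Proof.
rewrite /coboundary; case: ifP => // _.
exact: fsum_finite_combination.
Qed.

Lemma cobound0 : cobound 0 = 0.
Proof. by apply/funext => s; rewrite /cobound big1 // => k _; rewrite subrr mulr0. Qed.

Lemma coboundB f g : cobound (f - g) = cobound f - cobound g.
Proof.
apply/funext => s; rewrite /cobound !fctE -sumrB; apply: eq_bigr => k _.
by rewrite -mulrBr; congr (_ * _); ring.
Qed.

Lemma coboundD f g : cobound (f + g) = cobound f + cobound g.
Proof.
have -> : f + g = f - (0 - g) by rewrite sub0r opprK.
by rewrite !coboundB cobound0 sub0r opprK.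
Qed.

Lemma cobound_dim n f : dim_supp n f -> dim_supp n.+1 (cobound f).
Proof.
move=> fn s; apply: contra_neq_eq => sn; rewrite /cobound big1 // => k kS.
have z t : t.2 = s.2 :\ k -> f t = 0.
  move=> tE; apply: contra_neq_eq sn => /fn <-.
  by rewrite /cdim tE (cardsD1 k s.2) kS.
by rewrite !z // subrr mulr0.
Qed.

(** Removing the smaller index [k] lowers the position of [l] in [S] by one, while removing [l]
    leaves the position of [k] unchanged. *)
Lemma coface_sign_swap S (k l : 'I_d) : k \in S -> l \in S -> (k < l)%N ->
  coface_sign S k * coface_sign (S :\ k) l =
  - (coface_sign S l * coface_sign (S :\ l) k).
Proof.
move=> kS lS kl.
have -> : coface_sign (S :\ l) k = coface_sign S k.
  congr (_ ^+ _); apply: eq_card => j; rewrite !inE.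
  by case: (eqVneq j l) => [->|//]; rewrite andbC; case: ltngtP kl; rewrite ?andbF.
suff -> : coface_sign S l = - coface_sign (S :\ k) l by ring.
rewrite /coface_sign (cardD1 k) !inE kS kl /= exprS mulN1r; congr (- (_ ^+ _)).
by apply: eq_card => j; rewrite !inE andbA.
Qed.

Lemma cobound_cobound f : cobound (cobound f) = 0.
Proof.
apply/funext => s; rewrite /cobound -[RHS]/0.
pose D k l := f (front (front s k) l) - f (back (front s k) l)
   - (f (front (back s k) l) - f (back (back s k) l)).
pose G k l := coface_sign s.2 k * coface_sign (s.2 :\ k) l * D k l.
have DC k l : D k l = D l k.
  rewrite /D /front /back /=.
  have -> : s.2 :\ k :\ l = s.2 :\ l :\ k by rewrite !finset.setDDl finset.setUC.
  by rewrite [s.1 + _ + _]addrAC; ring.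
have -> : \sum_(k in s.2) coface_sign s.2 k *
    (\sum_(l in (front s k).2) coface_sign (front s k).2 l *
      (f (front (front s k) l) - f (back (front s k) l)) -
     \sum_(l in (back s k).2) coface_sign (back s k).2 l *
      (f (front (back s k) l) - f (back (back s k) l))) =
  \sum_(k in s.2) \sum_(l in s.2 | l != k) G k l.
  apply: eq_bigr => k kS; rewrite -sumrB mulr_sumr.
  apply: eq_big => l; first by rewrite !inE andbC.
  by move=> _; rewrite -mulrBr mulrA.
(* After exchanging the indices in the part with [l < k], each [G k l] is paired with [G l k]. They
   cancel: [D] is symmetric and the signs are antisymmetric. *)
have -> : \sum_(k in s.2) \sum_(l in s.2 | l != k) G k l =
  \sum_(k in s.2) \sum_(l in s.2 | (k < l)%N) G k l
  + \sum_(k in s.2) \sum_(l in s.2 | (l < k)%N) G k l.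
  rewrite -big_split; apply: eq_bigr => k kS /=.
  rewrite (bigID [pred l : 'I_d | (k < l)%N]) /=; congr (_ + _); apply: eq_bigl => l;
    by rewrite -andbA -val_eqE /=; case: ltngtP => //; rewrite ?andbF.
rewrite [X in _ + X](exchange_big_dep (mem s.2)) /=; last by move=> k l _ /andP[].
rewrite -big_split big1 // => k kS /=.
under [X in _ + X]eq_bigl => l do rewrite kS.
rewrite -big_split big1 // => l /andP[lS kl] /=.
by rewrite /G (coface_sign_swap kS lS kl) (DC l k); ring.
Qed.

End CellularCochains.

(** * The Poincare lemma for cochains of arbitrary support *)

Section PoincareLemma.
Variables (d q : nat).
Implicit Types (f g : cell d -> 'Z_q) (x : 'rV[int]_d) (S : {set 'I_d}).

Lemma coface_sign_sqr S k : coface_sign q S k * coface_sign q S k = 1.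
Proof. by rewrite /coface_sign -expr2 sqrr_sign. Qed.

(** The discrete antiderivative that vanishes at 0. Since [Negz m] is -(m + 1), the negative branch
    sums over -1, ..., -(m + 1). *)
Definition int_primitive (h : int -> 'Z_q) (n : int) : 'Z_q :=
  match n with
  | Posz m => \sum_(j < m) h (Posz j)
  | Negz m => - \sum_(j < m.+1) h (Negz j)
  end.

Lemma int_primitiveS h n : int_primitive h (n + 1) - int_primitive h n = h n.
Proof.
case: n => [m|[|m]].
- by rewrite -PoszD addn1 /= big_ord_recr /= addrAC subrr add0r.
- by rewrite /= big_ord0 big_ord1 opprK add0r.
- have -> : Negz m.+1 + 1 = Negz m by lia.
  by rewrite /= [in X in _ - X]big_ord_recr /= opprK addrA addNr add0r.
Qed.

Lemma int_primitive0 h n : (forall m, h m = 0) -> int_primitive h n = 0.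
Proof. by move=> h0; case: n => m /=; rewrite big1 ?oppr0. Qed.

Definition set_coord x (k : 'I_d) (n : int) : 'rV[int]_d :=
  \row_j if j == k then n else x 0 j.

(** Homotopy operator in direction [k]: [g] is integrated along each line parallel to the [k]-th
    axis, starting from the hyperplane where that coordinate is 0. *)
Definition primitive (k : 'I_d) g : cell d -> 'Z_q := fun s =>
  if k \in s.2 then 0 else
  coface_sign q (k |: s.2) k *
    int_primitive (fun n => g (set_coord s.1 k n, k |: s.2)) (s.1 0 k).

Lemma primitive_dim k n g : dim_supp n.+1 g -> dim_supp n (primitive k g).
Proof.
move=> gn [x S]; rewrite /primitive /cdim /=; case: ifPn => [|kS]; first by rewrite eqxx.
apply: contra_neq_eq => Sn; rewrite int_primitive0 ?mulr0 // => m.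
apply: contra_neq_eq Sn => /gn; rewrite /cdim /= cardsU1 kS add1n.
by case.
Qed.

(* Subtracting the coboundary of the primitive kills all cells having an edge in
   direction k, without destroying what was achieved for smaller directions. *)
Lemma primitive_step (k : 'I_d) g : cobound g = 0 ->
  (forall x S (j : 'I_d), j \in S -> (j < k)%N -> g (x, S) = 0) ->
  forall x S (j : 'I_d), j \in S -> (j <= k)%N ->
    (g - cobound (primitive k g)) (x, S) = 0.
Proof.
move=> gcl g0 x S j jS jk; rewrite !fctE.
have [kS|kS] := boolP (k \in S).
  (* The primitive vanishes on cells with an edge in direction [k], so only the two faces across [k]
     contribute; their difference is a difference of consecutive values of [int_primitive], which
     returns [g]. *)
  rewrite /cobound (bigD1 k) //= big1 ?addr0; last first.
    move=> l /andP[lS lk]; rewrite /primitive /=.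
    by rewrite !inE eq_sym lk kS /= subrr mulr0.
  rewrite /primitive /= !inE eqxx /= finset.setD1K // -mulrBr mulrA coface_sign_sqr mul1r.
  have -> : (x + delta_mx 0 k) 0 k = x 0 k + 1 by rewrite !mxE !eqxx.
  have xE n : set_coord (x + delta_mx 0 k) k n = set_coord x k n.
    by apply/rowP => l; rewrite !mxE; case: ifP => // ->; rewrite andbF addr0.
  under eq_fun => n do rewrite xE.
  rewrite int_primitiveS.
  have -> : set_coord x k (x 0 k) = x.
    by apply/rowP => l; rewrite !mxE; case: eqP => // ->.
  by rewrite subrr.
have jk' : (j < k)%N.
  by rewrite ltn_neqAle jk andbT; apply: contraNneq kS => /val_inj <-.
have jneqk : j != k by rewrite -val_eqE /= ltn_eqF.
rewrite (g0 _ _ _ jS jk') sub0r; apply/eqP; rewrite oppr_eq0; apply/eqP.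
rewrite /cobound (bigD1 j) //= big1 ?addr0; last first.
  move=> l /andP[lS lj]; rewrite /primitive /= !inE (negbTE kS) andbF.
  by rewrite !int_primitive0 ?mulr0 ?subrr ?mulr0 // => n;
     apply: (g0 _ _ j) => //; rewrite !inE jS [j == l]eq_sym lj orbT.
rewrite /primitive /= !inE (negbTE kS) andbF.
have -> : (x + delta_mx 0 j) 0 k = x 0 k by rewrite !mxE eq_sym (negbTE jneqk) andbF addr0.
(* Evaluate [cobound g = 0] at a cell with edges [k |: S]. Faces that keep the edge [j] are killed
   by [g0], so [g] agrees on the two faces across [j], and hence so do its primitives. *)
have -> : (fun n => g (set_coord (x + delta_mx 0 j) k n, k |: S :\ j)) =
   (fun n => g (set_coord x k n, k |: S :\ j)).
  apply/funext => n.
  have := congr1 (fun h => h (set_coord x k n, k |: S)) gcl.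
  have jkS : j \in k |: S by rewrite !inE jS orbT.
  rewrite /cobound (bigD1 j) //= big1 ?addr0; last first.
    move=> l /andP[lS lj].
    by rewrite !(g0 _ _ j) ?subrr ?mulr0 // !inE jS [j == l]eq_sym lj orbT.
  move=> /(congr1 (fun z => coface_sign q (k |: S) j * z)).
  rewrite mulrA coface_sign_sqr mul1r mulr0 /front /back /= => /eqP.
  have -> : (k |: S) :\ j = k |: S :\ j.
    by apply/setP => l; rewrite !inE; case: (eqVneq l j) => //= ->; rewrite (negbTE jneqk).
  rewrite subr_eq0 => /eqP <-; congr (g (_, _)).
  apply/rowP => l; rewrite !mxE; case: (eqVneq l k) => // ->.
  by rewrite eq_sym (negbTE jneqk) andbF addr0.
by rewrite subrr mulr0.
Qed.

(** The directions are treated one at a time by [primitive_step]. After all [d] of them only cells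
    without edges remain, and a cochain of degree [n.+1] vanishes there. *)
Lemma poincare n g : dim_supp n.+1 g -> cobound g = 0 ->
  exists2 f, dim_supp n f & g = cobound f.
Proof.
move=> gn gcl.
suff H m : (m <= d)%N -> exists2 f, dim_supp n f &
    forall x S (j : 'I_d), j \in S -> (j < m)%N -> (g - cobound f) (x, S) = 0.
  have [f fn f0] := H d (leqnn d); exists f => //.
  apply/eqP; rewrite -subr_eq0; apply/eqP/funext => -[x S].
  have [->|[j jS]] := set_0Vmem S; last exact: (f0 _ _ j).
  have z h : dim_supp n.+1 h -> h (x, finset.set0) = 0.
    move=> hn; have [//|/hn] := eqVneq (h (x, finset.set0)) 0.
    by rewrite /cdim cards0.
  by rewrite !fctE !z ?subrr //; apply: cobound_dim.
elim: m => [_|m IH md].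
  by exists 0 => // s; rewrite eqxx.
have [f fn f0] := IH (ltnW md).
pose k := Ordinal md.
exists (f + primitive k (g - cobound f)).
  have pn : dim_supp n (primitive k (g - cobound f)).
    apply: primitive_dim => s; rewrite !fctE; apply: contra_neq_eq => sn.
    have -> : g s = 0 by apply: contra_neq_eq sn => /gn.
    have -> : cobound f s = 0 by apply: contra_neq_eq sn => /(cobound_dim fn).
    by rewrite subrr.
  move=> s; rewrite !fctE; apply: contra_neq_eq => sn.
  have -> : f s = 0 by apply: contra_neq_eq sn => /fn.
  by rewrite add0r; apply: contra_neq_eq sn => /pn.
move=> x S j jS jm; rewrite coboundD opprD addrA.
by apply: (primitive_step _ _ x jS) => //; rewrite coboundB gcl cobound_cobound subrr.
Qed.

End PoincareLemma.

(** * Cardinalities of finite groups and of their images *)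

Section Counting.

(** Each fibre of [f] in [U] is a translate of the part of [N] in [U]. The target [W] is a bare
    [choiceType], so that [f] may send an element to its coset, seen as a set. *)
Lemma card_group_image (V : zmodType) (W : choiceType) (U N : set V) (f : V -> W) :
  finite_set U -> U 0 -> (forall x y, U x -> U y -> U (x - y)) ->
  (forall x y, U x -> U y -> (f x = f y <-> N (x - y))) ->
  #|` fset_set U| = (#|` fset_set (f @` U)| * #|` fset_set (U `&` N)|)%N.
Proof.
move=> finU U0 UB fN.
rewrite fset_set_image // card_fset_sum1 (partition_big_imfset _ f) /=.
rewrite -sum1_size big_distrl /= !big_seq; apply: eq_bigr => w /imfsetP[x /=].
rewrite in_fset_set // inE => Ux ->; rewrite mul1n sum1_count -size_filter.
have -> : size (fset_set (U `&` N)) = size [seq n + x | n <- fset_set (U `&` N)].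
  by rewrite size_map.
have UD y z : U y -> U z -> U (y + z).
  move=> Uy Uz; have -> : y + z = y - (0 - z) by rewrite sub0r opprK.
  by apply: (UB) => //; apply: UB.
have finUN : finite_set (U `&` N) by apply: finite_setIl.
apply/perm_size/uniq_perm.
- exact/filter_uniq/fset_uniq.
- by rewrite map_inj_uniq ?fset_uniq //; apply: addIr.
move=> y; rewrite mem_filter in_fset_set //; apply/andP/mapP.
  rewrite inE => -[/eqP fyx Uy]; exists (y - x); last by rewrite subrK.
  by rewrite in_fset_set // inE; split; [apply: UB|apply/fN].
move=> [n]; rewrite in_fset_set // inE => -[Un Nn] ->; rewrite inE; split.
  by apply/eqP/fN => //; [apply: UD|rewrite addrK].
exact: UD.
Qed.

Lemma card_inj_image (T U : choiceType) (f : T -> U) (A : set T) :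
  injective f -> finite_set A -> #|` fset_set (f @` A)| = #|` fset_set A|.
Proof. by move=> fi fA; rewrite fset_set_image // card_imfset. Qed.

Lemma finite_supported_functions (T : choiceType) (U : finType) (u : U) (A : set T) :
  finite_set A -> finite_set [set f : T -> U | forall t, f t != u -> A t].
Proof.
move=> finA; pose F := fset_set A.
pose ext (h : {ffun F -> U}) (t : T) := if insub t is Some v then h v else u.
apply: (@sub_finite_set _ _ (ext @` setT)); last exact/finite_image/finite_finset.
move=> f /= fA; exists [ffun v : F => f (val v)] => //.
apply/funext => t; rewrite /ext; case: insubP => [v _ <-|]; first by rewrite ffunE.
rewrite in_fset_set // notin_setE => nA.
by apply/esym/eqP; apply: contra_notT nA => /fA.
Qed.

End Counting.

(** * How local cocycles and coboundaries change when a plaquette opens *)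

Section LocalDuality.
Variables (d q n : nat).
Hypothesis q_gt1 : (1 < q)%N.
Variables (K0 B I O0 : set (cell d)).
Hypotheses (finK0 : finite_set K0) (finI : finite_set I).
Hypothesis dimB : forall s, B s -> cdim s = n.+1.
Hypothesis B_faces : forall (s : cell d) k, B s -> k \in s.2 -> K0 (front s k) /\ K0 (back s k).
Hypothesis B_cofaces : forall (s : cell d) k, k \in s.2 -> B (front s k) \/ B (back s k) -> I s.
Hypothesis disjB : forall s, B s -> ~ O0 s.
Implicit Types (f g h : cell d -> 'Z_q) (A : set (cell d)) (e s : cell d).

(* B and K0 are the i-plaquettes and the lower cells of the box, I the cells meeting
   its interior, O0 the open plaquettes outside the box, and A those inside. *)
Definition cocycles_off A : set (cell d -> 'Z_q) :=
  [set f | dim_supp n f /\ forall s, (A `|` O0) s -> cobound f s = 0].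

(** The group Z(P) of the overview, with [A] the open plaquettes of the box. *)
Definition local_cocycles A := restriction K0 @` cocycles_off A.

(** The group B(P) of the overview. The cochain [g] may have infinite support; only its coboundary
    is confined to [I]. *)
Definition local_coboundaries A : set (cell d -> 'Z_q) :=
  [set h | (forall s, h s != 0 -> I s) /\
    exists g, [/\ dim_supp n.+1 g, forall s, (A `|` O0) s -> g s = 0 & h = cobound g]].

Lemma dim_suppB m f g : dim_supp m f -> dim_supp m g -> dim_supp m (f - g).
Proof.
move=> fm gm s; rewrite !fctE; apply: contra_neq_eq => sm.
have -> : f s = 0 by apply: contra_neq_eq sm => /fm.
by rewrite sub0r; apply/eqP; rewrite oppr_eq0; apply: contra_neqT sm => /gm.
Qed.

Lemma restrictionB X f g : restriction X (f - g) = restriction X f - restriction X g.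
Proof. by apply/funext => s; rewrite /restriction !fctE; case: ifP => // _; rewrite subrr. Qed.

Lemma cocycles_offB A f g :
  cocycles_off A f -> cocycles_off A g -> cocycles_off A (f - g).
Proof.
move=> [fn f0] [gn g0]; split; first exact: dim_suppB.
by move=> s As; rewrite coboundB !fctE f0 // g0 // subrr.
Qed.

Lemma cocycles_off0 A : cocycles_off A 0.
Proof. by split=> [s|s _]; rewrite ?cobound0 ?eqxx. Qed.

Lemma local_cocycles0 A : local_cocycles A 0.
Proof.
exists 0; first exact: cocycles_off0.
by apply/funext => s; rewrite /restriction; case: ifP.
Qed.

Lemma local_cocyclesB A f g :
  local_cocycles A f -> local_cocycles A g -> local_cocycles A (f - g).
Proof.
move=> [f' fA <-] [g' gA <-]; rewrite -restrictionB.
by exists (f' - g') => //; apply: cocycles_offB.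
Qed.

Lemma finite_local_cocycles A : finite_set (local_cocycles A).
Proof.
apply: (sub_finite_set _ (@finite_supported_functions _ _ (0 : 'Z_q) _ finK0)).
move=> _ [f _ <-] s; rewrite /restriction; case: ifPn => [|_]; last by rewrite eqxx.
by rewrite inE.
Qed.

Lemma local_coboundaries0 A : local_coboundaries A 0.
Proof.
split=> [s|]; first by rewrite eqxx.
by exists 0; split; rewrite ?cobound0 // => s; rewrite eqxx.
Qed.

Lemma local_coboundariesB A f g :
  local_coboundaries A f -> local_coboundaries A g -> local_coboundaries A (f - g).
Proof.
move=> [fI [f' [fn f0 fE]]] [gI [g' [gn g0 gE]]]; split.
  move=> s; rewrite !fctE; apply: contra_neqP => nI.
  have -> : f s = 0 by apply: contra_notP nI => /eqP /fI.
  have -> : g s = 0 by apply: contra_notP nI => /eqP /gI.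
  by rewrite subrr.
exists (f' - g'); split; [exact: dim_suppB| |by rewrite coboundB fE gE].
by move=> s As; rewrite !fctE f0 // g0 // subrr.
Qed.

Lemma finite_local_coboundaries A : finite_set (local_coboundaries A).
Proof.
apply: (sub_finite_set _ (@finite_supported_functions _ _ (0 : 'Z_q) _ finI)).
by move=> f [fI _].
Qed.

(** All faces of a plaquette of the box lie in [K0], so evaluating [cobound] at [e] makes sense on
    restricted cocycles. *)
Lemma cobound_restriction f e : B e -> cobound (restriction K0 f) e = cobound f e.
Proof.
move=> Be; apply: eq_bigr => k ke; have [Kf Kb] := B_faces Be ke.
by rewrite /restriction !mem_set.
Qed.

Definition indicator e (c : 'Z_q) : cell d -> 'Z_q := fun s => c * (s == e)%:R.

Lemma indicator_dim e c : B e -> dim_supp n.+1 (indicator e c).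
Proof.
move=> Be s; rewrite /indicator; have [->|_] := eqVneq s e; first by rewrite dimB.
by rewrite mulr0 eqxx.
Qed.

Lemma cobound_indicator e c s : B e -> cobound (indicator e c) s != 0 -> I s.
Proof.
move=> Be; apply: contra_neqP => nI; rewrite /cobound big1 // => k ks.
have E t : t = front s k \/ t = back s k -> indicator e c t = 0.
  rewrite /indicator; have [-> et|_ _] := eqVneq t e; last by rewrite mulr0.
  by case: nI; apply: (B_cofaces ks); case: et => <-; [left|right].
by rewrite !E ?subrr ?mulr0; auto.
Qed.

Section OnePlaquette.
Variables (A : set (cell d)) (e : cell d).
Hypotheses (Be : B e) (nAe : ~ A e).

(** The subgroup V of the overview. *)
Definition coboundary_values : set 'Z_q :=
  [set cobound f e | f in cocycles_off A].

Lemma nOe s : (A `|` O0) s -> (s == e) = false.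
Proof. by move=> As; apply/eqP => se; case: As; rewrite se //; apply: disjB. Qed.

(** Evaluation of [cobound] at [e] maps onto [coboundary_values], and its kernel consists of the
    local cocycles for [A] with [e] added. *)
Lemma card_local_cocycles :
  #|` fset_set (local_cocycles A)| =
  (#|` fset_set coboundary_values| * #|` fset_set (local_cocycles (e |` A))|)%N.
Proof.
rewrite (@card_group_image _ _ _ [set f | cobound f e = 0] (fun f => cobound f e));
  [|exact: finite_local_cocycles|exact: local_cocycles0|exact: local_cocyclesB|].
  congr (_ * _)%N; congr (size (fset_set _)); apply/seteqP; split.
  - by move=> _ [_ [f fA <-] <-]; exists f => //; rewrite cobound_restriction.
  - move=> _ [f fA <-]; exists (restriction K0 f); first by exists f.
    by rewrite cobound_restriction.
  - move=> _ [[f [fn f0] <-] /=]; rewrite cobound_restriction // => fe.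
    by exists f => //; split=> // s [[->//|As]|Os]; apply: f0; [left|right].
  - move=> _ [f [fn f0] <-]; split.
      by exists f => //; split=> // s [As|Os]; apply: f0; [left; right|right].
    by rewrite /= cobound_restriction //; apply: f0; left; left.
move=> f g _ _ /=; rewrite coboundB !fctE; split=> [->|/eqP]; first by rewrite subrr.
by rewrite subr_eq0 => /eqP.
Qed.

Definition coset h : set (cell d -> 'Z_q) :=
  [set g | local_coboundaries (e |` A) (g - h)].

Lemma coset_eq g h : coset g = coset h <-> local_coboundaries (e |` A) (g - h).
Proof.
pose N := local_coboundaries (e |` A).
have NN f : N f -> N (- f).
  by rewrite -[- f]sub0r => Nf; apply: local_coboundariesB => //; apply: local_coboundaries0.
split=> [gh|Ngh].
  have : coset g g by rewrite /coset /= subrr; apply: local_coboundaries0.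
  by rewrite gh.
apply/seteqP; split=> f /= Nf.
  by have := local_coboundariesB Nf (NN _ Ngh); rewrite opprK addrA subrK.
by have := local_coboundariesB Nf Ngh; rewrite opprB addrA subrK.
Qed.

(* The converse direction is where the Poincare lemma enters. *)
Lemma local_coboundaries_indicator c :
  coboundary_values c <-> local_coboundaries (e |` A) (cobound (indicator e c)).
Proof.
split=> [[f [fn f0] <-]|[_ [g [gn g0 gE]]]].
  split=> [s|]; first exact: cobound_indicator.
  (* Subtracting [cobound f] leaves the coboundary unchanged and makes the cochain vanish at [e] as
     well. *)
  exists (indicator e (cobound f e) - cobound f); split.
  - by apply: dim_suppB; [apply: indicator_dim|apply: cobound_dim].
  - move=> s As; rewrite !fctE /indicator.
    have [->|se] := eqVneq s e; first by rewrite mulr1 subrr.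
    rewrite mulr0 f0 ?subrr //; case: As => [[/eqP|]|]; [by rewrite (negbTE se)|by left|by right].
  - by rewrite coboundB cobound_cobound subr0.
have /poincare [] : dim_supp n.+1 (indicator e c - g).
- by apply: dim_suppB => //; apply: indicator_dim.
- by rewrite coboundB gE subrr.
move=> f fn fE; exists f.
  split=> // s As; rewrite -fE !fctE /indicator (nOe As) mulr0 g0 ?subrr //.
  by case: As => ?; [left; right|right].
by rewrite -fE !fctE /indicator eqxx mulr1 g0 ?subr0 //; left; left.
Qed.

(** The quotient of the two coboundary groups is counted a second time as the image of ['Z_q] under
    [c] mapped to the class of [cobound (indicator e c)]. By [local_coboundaries_indicator] the
    kernel of this map is [coboundary_values]. *)
Lemma card_local_coboundaries :
  (#|` fset_set (local_coboundaries A)| * #|` fset_set coboundary_values| =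
   q * #|` fset_set (local_coboundaries (e |` A))|)%N.
Proof.
have subN : local_coboundaries (e |` A) `<=` local_coboundaries A.
  move=> h [hI [g [gn g0 hE]]]; split=> //; exists g; split=> // s As.
  by apply: g0; case: As => ?; [left; right|right].
rewrite (@card_group_image _ _ _ (local_coboundaries (e |` A)) coset);
  [|exact: finite_local_coboundaries|exact: local_coboundaries0
   |exact: local_coboundariesB|by move=> *; apply: coset_eq].
rewrite (setIidr subN).
have indB c c' : indicator e (c - c') = indicator e c - indicator e c'.
  by apply/funext => s; rewrite /indicator !fctE mulrBl.
have finq : finite_set [set: 'Z_q] by apply: (@finite_finset (ordinal _)).
have cardq : #|` fset_set [set: 'Z_q]| = q.
  have -> : fset_set [set: 'Z_q] = [fset x in 'Z_q]%fset.
    by apply/fsetP => x; rewrite in_fset_set // mem_setT !inE.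
  by rewrite card_finset card_ord Zp_cast.
have := @card_group_image _ _ _ coboundary_values
  (fun c => coset (cobound (indicator e c))) finq.
rewrite setTI cardq => cq.
have {}cq := cq Logic.I (fun _ _ _ _ => Logic.I).
suff -> : coset @` local_coboundaries A =
    (fun c => coset (cobound (indicator e c))) @` [set: 'Z_q].
  rewrite mulnAC -cq // => c c' _ _.
  by rewrite coset_eq local_coboundaries_indicator indB coboundB.
apply/seteqP; split.
  (* The class of [cobound g] depends only on [g e]: once the indicator with that value is
     subtracted, the cochain vanishes at [e] too. *)
  move=> _ [h [hI [g [gn g0 hE]]] <-]; exists (g e) => //.
  apply/coset_eq; split.
    move=> s; rewrite hE -coboundB; apply: contra_neqP => nI.
    rewrite coboundB !fctE -hE.
    have -> : h s = 0 by apply: contra_notP nI => /eqP /hI.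
    rewrite subr0.
    by apply: contra_notP nI => /eqP /cobound_indicator; apply.
  exists (indicator e (g e) - g); split; last by rewrite hE coboundB.
    by apply: dim_suppB => //; apply: indicator_dim.
  move=> s As; rewrite !fctE /indicator.
  have [->|se] := eqVneq s e; first by rewrite mulr1 subrr.
  by rewrite mulr0 g0 ?subrr //; case: As => [[/eqP|]|]; [rewrite (negbTE se)|left|right].
move=> _ [c _ <-]; exists (cobound (indicator e c)) => //; split.
  by move=> s; apply: cobound_indicator.
exists (indicator e c); split=> //; first exact: indicator_dim.
by move=> s As; rewrite /indicator (nOe As) mulr0.
Qed.

End OnePlaquette.

(** Opening [e] divides the number of cocycles by |V| and multiplies the number of coboundaries by
    |V| / q. So |V| cancels, and the power of [q] absorbs the remaining factor. *)
Lemma card_local_duality A : finite_set A -> A `<=` B ->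
  (#|` fset_set (local_cocycles A)| * #|` fset_set (local_coboundaries A)|
     * q ^ #|` fset_set A| =
   #|` fset_set (local_cocycles set0)| * #|` fset_set (local_coboundaries set0)|)%N.
Proof.
move=> finA; rewrite -{1 2 3}(fset_setK finA).
elim/finSet_rect: (fset_set A) => X IH XB.
have [->|[e eX]] := fset_0Vmem X.
  by rewrite set_fset0 cardfs0 expn0 muln1.
have XE : [set` X] = e |` [set` (X `\ e)%fset].
  apply/seteqP; split=> s /=; rewrite !inE.
    by have [->|] := eqVneq s e; [left|right; apply/andP].
  by case=> [->//|/andP[]].
have YB : [set` (X `\ e)%fset] `<=` B.
  by move=> s /=; rewrite !inE => /andP[_ sX]; apply: XB.
have Be : B e by apply: XB.
have ne : ~ [set` (X `\ e)%fset] e by rewrite /= !inE eqxx.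
rewrite -(IH (X `\ e)%fset) ?fproperD1 //.
rewrite (cardfsD1 e X) eX /= add1n expnS.
have := card_local_coboundaries Be ne; rewrite -XE.
rewrite (card_local_cocycles [set` (X `\ e)%fset] Be) -XE => E2.
move: E2; set zx := #|` fset_set (local_cocycles _)|.
set bx := #|` fset_set (local_coboundaries [set` X])|.
set b := #|` fset_set (local_coboundaries _)|; set h := #|` _|; set r := expn _ _ => E2.
by rewrite mulnA -[(_ * _ * q)%N]mulnA [(bx * q)%N]mulnC -E2; ring.
Qed.

End LocalDuality.

(** * Dual cells, exchanging boundary and coboundary *)

Section Duality.
Variables (d q : nat).
Implicit Types (f g : cell d -> 'Z_q) (s t : cell d) (S : {set 'I_d}).

(** Dual coordinates are read with offset 1/2. In a direction missing from [s.2] the dual edge runs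
    from x - 1/2 to x + 1/2, so its lower corner is indexed by x - 1; in a direction of [s.2] the
    dual sits at x + 1/2, indexed by x. *)
Definition dual_cell s : cell d := (s.1 - \row_k (k \notin s.2)%:R, ~: s.2).
Definition primal_cell t : cell d := (t.1 + \row_k (k \in t.2)%:R, ~: t.2).

Lemma dual_cellK : cancel dual_cell primal_cell.
Proof.
case=> x S; rewrite /primal_cell /dual_cell /= finset.setCK; congr (_, _).
by apply/rowP => k; rewrite !mxE !inE subrK.
Qed.

Lemma primal_cellK : cancel primal_cell dual_cell.
Proof.
case=> x S; rewrite /primal_cell /dual_cell /= finset.setCK; congr (_, _).
by apply/rowP => k; rewrite !mxE !inE negbK addrK.
Qed.

Lemma cdim_dual s : cdim (dual_cell s) = (d - cdim s)%N.
Proof. by rewrite /cdim cardsCs finset.setCK card_ord. Qed.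

Lemma cdim_primal t : cdim (primal_cell t) = (d - cdim t)%N.
Proof. by rewrite /cdim cardsCs finset.setCK card_ord. Qed.

Lemma cdim_le s : (cdim s <= d)%N.
Proof. by rewrite -[X in (_ <= X)%N]card_ord max_card. Qed.

(** The incidence numbers are regrouped by the cofaces of [t]: the boundary of an infinite chain is
    a finite sum only when computed cell by cell. *)
Lemma bcoef_coface s t :
  bcoef q s t = \sum_(k | k \notin t.2) coface_sign q (k |: t.2) k *
    ((s == (t.1 - delta_mx 0 k, k |: t.2))%:R - (s == (t.1, k |: t.2))%:R).
Proof.
rewrite /bcoef big_mkcond [RHS]big_mkcond /=; apply: eq_bigr => k _.
case: s t => [x S] [y T] /=; rewrite !xpair_eqE.
have [[kT ST]|nST] := pselect (k \notin T /\ S = k |: T).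
  rewrite ST !inE eqxx kT /= finset.setU1K // !eqxx !andbT /coface_sign.
  by rewrite [x == y - _]eq_sym subr_eq [x == y]eq_sym.
have [kS|kS] := boolP (k \in S); last first.
  case: ifP => // kT; have /negPf-> : S != k |: T.
    by apply: contraNneq kS => ->; rewrite !inE eqxx.
  by rewrite !andbF subrr mulr0.
have /negPf-> : T != S :\ k.
  by apply/eqP => TE; apply: nST; rewrite TE !inE eqxx finset.setD1K.
rewrite !andbF subrr mulr0; have [kT|//] := boolP (k \notin T).
have /negPf-> : S != k |: T by apply/eqP => SE; apply: nST.
by rewrite !andbF subrr mulr0.
Qed.

Lemma boundaryE f t :
  boundary f t = \sum_(k | k \notin t.2) coface_sign q (k |: t.2) k *
    (f (t.1 - delta_mx 0 k, k |: t.2) - f (t.1, k |: t.2)).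
Proof.
rewrite /boundary; under eq_fsbigr do rewrite bcoef_coface.
exact: fsum_finite_combination.
Qed.

(* The signs for which dualizing intertwines the boundary and the coboundary. *)
Definition dual_sign S : 'Z_q := (-1) ^+ (\sum_(j in S) j.+1).

Lemma dual_sign_sqr S : dual_sign S * dual_sign S = 1.
Proof. by rewrite /dual_sign -expr2 sqrr_sign. Qed.

Definition transport g : cell d -> 'Z_q :=
  fun t => dual_sign (primal_cell t).2 * g (primal_cell t).

Definition untransport f : cell d -> 'Z_q :=
  fun s => dual_sign s.2 * f (dual_cell s).

Lemma transportK : cancel transport untransport.
Proof.
move=> g; apply/funext => s.
by rewrite /untransport /transport dual_cellK mulrA dual_sign_sqr mul1r.
Qed.

Lemma untransportK : cancel untransport transport.
Proof.
move=> g; apply/funext => s.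
by rewrite /untransport /transport primal_cellK mulrA dual_sign_sqr mul1r.
Qed.

Lemma transport_eq0 g t : (transport g t == 0) = (g (primal_cell t) == 0).
Proof.
apply/eqP/eqP => [|gt0]; last by rewrite /transport gt0 mulr0.
move=> /(congr1 (fun z => dual_sign (primal_cell t).2 * z)).
by rewrite mulrA dual_sign_sqr mul1r mulr0.
Qed.

Lemma card_ord_below (k : 'I_d) : #|[pred j : 'I_d | (j < k)%N]| = k.
Proof.
rewrite -sum1_card; under eq_bigl => j do rewrite inE.
rewrite (big_ord_narrow (ltnW (ltn_ord k))) /=.
by rewrite sum1_card card_ord.
Qed.

(** Dropping [k] from [S] lowers the exponent by [k.+1], and [k] is the number of indices below [k]
    inside [S] plus the number outside it. The extra unit gives the minus sign. *)
Lemma dual_signD1 S k : k \in S ->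
  dual_sign S * coface_sign q S k =
  - (coface_sign q (k |: ~: S) k * dual_sign (S :\ k)).
Proof.
move=> kS; rewrite /dual_sign (bigD1 k) //= exprD exprS mulN1r.
have -> : \sum_(j in S | j != k) j.+1 = \sum_(j in S :\ k) j.+1.
  by apply: eq_bigl => j; rewrite !inE andbC.
set z := (-1) ^+ (\sum_(j in _) _).
rewrite !mulNr -mulrA [z * _]mulrC mulrA; congr (- (_ * _)).
rewrite /coface_sign; set a := #|_|; set b := #|_|.

have -> : k = (a + b)%N :> nat.
  rewrite -[LHS]card_ord_below -(cardID (mem S)); congr addn.
    by apply: eq_card => j; rewrite !inE andbC.
  apply: eq_card => j; rewrite !inE; case: (eqVneq j k) => //= ->.
  by rewrite ltnn andbF.
by rewrite exprD mulrAC -expr2 sqrr_sign mul1r.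
Qed.

(** Dualizing turns the shifted coface of [t] into the back face and the unshifted one into the
    front face. This reversal is compensated by the minus sign of [dual_signD1]. *)
Lemma boundary_transport g : boundary (transport g) = transport (cobound g).
Proof.
apply/funext => t; rewrite boundaryE /transport /cobound mulr_sumr.
apply: eq_big => [k|k kt]; first by rewrite !inE.
have kt' : k \in (primal_cell t).2 by rewrite !inE.
rewrite mulrA dual_signD1 // mulNr -mulrN opprB /= finset.setCK -mulrA mulrBr.
have E1 : primal_cell (t.1 - delta_mx 0 k, k |: t.2) = back (primal_cell t) k.
  rewrite /back /primal_cell /=; congr (_, _); last first.
    by apply/setP => j; rewrite !inE negb_or.
  apply/rowP => j; rewrite !mxE !inE eqxx /=.
  have [->|_] := eqVneq j k; last by rewrite subr0.
  by rewrite (negbTE kt) subrK addr0.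
have E2 : primal_cell (t.1, k |: t.2) = front (primal_cell t) k.
  rewrite /front /primal_cell /=; congr (_, _); last first.
    by apply/setP => j; rewrite !inE negb_or.
  apply/rowP => j; rewrite !mxE !inE eqxx /=.
  have [->|_] := eqVneq j k; last by rewrite addr0.
  by rewrite (negbTE kt) addr0.
rewrite E1 E2 /back /front /=.
have <- : ~: (k |: t.2) = ~: t.2 :\ k by apply/setP => j; rewrite !inE negb_or.
by rewrite -!mulrBr.
Qed.

Lemma transportB f g : transport (f - g) = transport f - transport g.
Proof. by apply/funext => s; rewrite /transport !fctE mulrBr. Qed.

End Duality.

(** * Integer descriptions of faces, boxes and duals *)

Section Geometry.
Variables (R : realType) (d : nat).
Implicit Types (s t : cell d).

(** It is enough to test the lowest and the highest corner of the cube. *)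
Lemma cube_subP (h : R) s (lo hi : 'I_d -> R) :
  cube h s `<=` [set y | forall k, lo k <= y 0 k <= hi k] <->
  forall k, lo k <= (s.1 0 k)%:~R + h /\ (s.1 0 k)%:~R + h + (k \in s.2)%:R <= hi k.
Proof.
split=> [sub k|lh y ys k]; last first.
  have [? ?] := lh k; have /andP[? ?] := ys k.
  by apply/andP; split; lra.
have /sub/(_ k) : cube h s (\row_j ((s.1 0 j)%:~R + h)).
  by move=> j; rewrite mxE lexx lerDl ler0n.
rewrite mxE => /andP[-> _]; split=> //.
have /sub/(_ k) : cube h s (\row_j ((s.1 0 j)%:~R + h + (j \in s.2)%:R)).
  by move=> j; rewrite mxE lexx lerDl ler0n.
by rewrite mxE => /andP[].
Qed.

Lemma intr_bool (b : bool) : b%:R = (b%:R : int)%:~R :> R.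
Proof. by case: b. Qed.

Lemma faceP t s : face R t s <-> forall k, s.1 0 k <= t.1 0 k /\
  t.1 0 k + (k \in t.2)%:R <= s.1 0 k + (k \in s.2)%:R.
Proof.
rewrite /face cube_subP; split=> H k; have := H k;
  by rewrite !addr0 !intr_bool -!intrD !ler_int.
Qed.

Lemma face_dim t s : face R t s -> t = s \/ (cdim t < cdim s)%N.
Proof.
case: t s => [y T] [x S] /faceP /= H.
have TS : T \subset S.
  apply/fintype.subsetP => k kT; have := H k; rewrite kT; case: (k \in S) => //; lia.
have [TE|nTE] := eqVneq T S; last first.
  by right; rewrite /cdim /= proper_card // finset.properEneq nTE.
left; rewrite TE; congr (_, _); apply/rowP => k.
by have := H k; rewrite TE => -[]; lia.
Qed.

Lemma face_front s k : k \in s.2 -> face R (front s k) s.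
Proof.
move=> ks; apply/faceP => j; rewrite !mxE !inE eqxx /=.
by have [->|_] := eqVneq j k; rewrite /= ?ks; split; lia.
Qed.

Lemma face_back s k : k \in s.2 -> face R (back s k) s.
Proof.
move=> ks; apply/faceP => j; rewrite !inE /=.
by have [->|_] := eqVneq j k; rewrite /= ?ks; split; lia.
Qed.

Lemma cdim_front s k : k \in s.2 -> cdim s = (cdim (front s k)).+1.
Proof. by move=> ks; rewrite /cdim (cardsD1 k) ks. Qed.

Lemma cdim_back s k : k \in s.2 -> cdim s = (cdim (back s k)).+1.
Proof. by move=> ks; rewrite /cdim (cardsD1 k) ks. Qed.

Lemma is_dualP s t : is_dual R s t <-> t = dual_cell s.
Proof.
split=> [|->]; last first.
  split; first by rewrite cdim_dual.
  (* The common point is the centre of [s]. *)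
  exists (\row_k ((s.1 0 k)%:~R + (k \in s.2)%:R / 2)); split=> k; rewrite !mxE.
    by case: (k \in s.2) => /=; apply/andP; split; lra.
  rewrite !inE intrB -intr_bool.
  by case: (k \in s.2) => /=; apply/andP; split; lra.
case: s t => [x S] [y T]; rewrite /is_dual /cdim /= => -[TS [z [zs zt]]].
(* If neither cell had an edge in direction [k], an integer would equal a half-integer. With the
   dimension count this forces [T] to be the complement of [S]. *)
have STk k : (k \in S) || (k \in T).
  have := zs k; have := zt k; rewrite /=.
  case: (k \in S) => //=; case: (k \in T) => //= /andP[h1 h2] /andP[h3 h4].
  have h : (x 0 k * 2)%:~R = (y 0 k * 2 + 1)%:~R :> R by rewrite intrD !intrM; lra.
  by move/intr_inj: h; lia.
have TE : T = ~: S.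
  apply/esym/eqP; rewrite eqEcard; apply/andP; split.
    by apply/fintype.subsetP => k; rewrite inE => /negbTE kS; have := STk k; rewrite kS.
  by rewrite TS [X in (_ <= X)%N]cardsCs finset.setCK card_ord.
rewrite /dual_cell /= TE; congr (_, _); apply/rowP => k; rewrite !mxE.
have := zs k; have := zt k; rewrite /= TE inE.
case: (k \in S) => /= /andP[h1 h2] /andP[h3 h4].
  have h5 : ((y 0 k) * 2)%:~R < (x 0 k * 2 + 2)%:~R :> R by rewrite intrD !intrM; lra.
  have h6 : ((x 0 k) * 2)%:~R < (y 0 k * 2 + 2)%:~R :> R by rewrite intrD !intrM; lra.
  move: h5 h6; rewrite !ltr_int; lia.
have h5 : ((y 0 k) * 2)%:~R < (x 0 k * 2)%:~R :> R by rewrite !intrM; lra.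
have h6 : ((x 0 k) * 2)%:~R < (y 0 k * 2 + 4)%:~R :> R by rewrite intrD !intrM; lra.
move: h5 h6; rewrite !ltr_int; lia.
Qed.

Variables (a b : 'rV[int]_d).

Definition in_cbox s := forall k, a 0 k <= s.1 0 k /\ s.1 0 k + (k \in s.2)%:R <= b 0 k.

(** Integer form of a cell of the closed box that meets the open box: a unit edge inside the box
    always reaches the interior, so only the directions without an edge need strict bounds. *)
Definition inner s := in_cbox s /\ forall k, k \notin s.2 -> a 0 k < s.1 0 k < b 0 k.

Lemma boxP i s : box R a b i s <->
  in_cbox s /\ ((cdim s <= i.-1)%N \/ cdim s = i /\ inner s).
Proof.
rewrite /box /= cube_subP.
have -> : (forall k, (a 0 k)%:~R + 0 <= (s.1 0 k)%:~R + 0 :> R /\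
    (s.1 0 k)%:~R + 0 + (k \in s.2)%:R <= (b 0 k)%:~R - 0 :> R) <-> in_cbox s.
  by split=> H k; have := H k; rewrite subr0 !addr0 intr_bool -intrD !ler_int.
split=> -[sc] [sd|[sd si]]; split=> //; try (by left); right; split=> //.
  split=> // k ks; case: si => y [ys yi].
  have := ys k; have := yi k; rewrite (negbTE ks) /= !addr0 => h /le_anti e.
  by move: h; rewrite -e !ltr_int.
exists (\row_k ((s.1 0 k)%:~R + (k \in s.2)%:R / 2)); split=> k; rewrite mxE.
  by case: (k \in s.2) => /=; apply/andP; split; lra.
have [ks|ks] := boolP (k \in s.2); last first.
  by rewrite mul0r addr0 !ltr_int; apply: si.2.
have [] := sc k; rewrite ks -2!(ler_int R) intrD /= => h1 h2.
by apply/andP; split; lra.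
Qed.

Lemma dual_boxP i t : dual_box R a b i t <->
  (forall k, a 0 k <= t.1 0 k /\ t.1 0 k + (k \in t.2)%:R + 1 <= b 0 k)
  /\ (cdim t <= d - i)%N.
Proof.
rewrite /dual_box /= cube_subP.
suff -> : (forall k, (a 0 k)%:~R + 2^-1 <= (t.1 0 k)%:~R + 2^-1 :> R /\
    (t.1 0 k)%:~R + 2^-1 + (k \in t.2)%:R <= (b 0 k)%:~R - 2^-1 :> R) <->
  (forall k, a 0 k <= t.1 0 k /\ t.1 0 k + (k \in t.2)%:R + 1 <= b 0 k) by [].
split=> H k; have := H k; rewrite -2!(ler_int R) !intrD -intr_bool -[1%:~R]/(1 : R);
  by move=> -[h1 h2]; split; lra.
Qed.

(** In a direction without an edge, the dual edge reaches 1/2 to both sides; fitting it into the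
    shrunken box is the strict inequality of [inner]. *)
Lemma dual_box_inner s i : (i <= d)%N -> dual_box R a b i (dual_cell s) <->
  inner s /\ (i <= cdim s)%N.
Proof.
move=> le_id; rewrite dual_boxP cdim_dual /=; have sd := cdim_le s.
split=> [[H sdi]|[[H1 H2] sdi]]; (split; last lia).
  split=> [k|k ks]; have := H k; rewrite !mxE !inE.
    by case: (k \in s.2) => /=; lia.
  by rewrite ks /=; lia.
move=> k; rewrite !mxE !inE; have := H1 k; have := H2 k; case: (k \in s.2) => /=; lia.
Qed.

End Geometry.

(** * Percolation subcomplexes of the box and of the dual box *)

Section Percolation.
Variables (R : realType) (d : nat).
Implicit Types (X P A : set (cell d)) (s t : cell d).

Definition has_lower_faces X i := forall s t, X s -> (cdim s <= i)%N ->
  face R t s -> (cdim t < cdim s)%N -> X t.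

Lemma percolation_setU X i A : (0 < i)%N -> has_lower_faces X i ->
  A `<=` plaquettes X i -> percolation R X i (skeleton X i.-1 `|` A).
Proof.
move=> i0 Xf AX; split.
- move=> s t Ps /[dup] st /face_dim[->//|ts]; left.
  have [Xs si] : X s /\ (cdim s <= i)%N.
    by case: Ps => [[Xs]|/AX[Xs ->]]; split=> //; lia.
  split; first exact: Xf st ts.
  by lia.
- by move=> s; left.
- by move=> s [[Xs si]|/AX[Xs si]]; split=> //; [lia|rewrite si].
Qed.

Lemma percolation_eq X i P : (0 < i)%N -> percolation R X i P ->
  P = skeleton X i.-1 `|` plaquettes P i.
Proof.
move=> i0 [_ XP PX]; apply/seteqP; split=> s; last by case=> [/XP|[]].
move=> Ps; have [Xs si] := PX _ Ps.
by have [?|?] := leqP (cdim s) i.-1; [left|right]; split=> //; lia.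
Qed.

Lemma percolation_plaquettes X i P : percolation R X i P ->
  plaquettes P i `<=` plaquettes X i.
Proof. by move=> [_ _ PX] s [Ps si]; have [] := PX _ Ps. Qed.

Lemma plaquettes_setU X i A : (0 < i)%N -> A `<=` plaquettes X i ->
  plaquettes (skeleton X i.-1 `|` A) i = A.
Proof.
move=> i0 AX; apply/seteqP; split=> s; last by move=> As; have [? ?] := AX _ As; split=> //; right.
by case=> -[[_ si] sE|//]; exfalso; lia.
Qed.

Variables (a b : 'rV[int]_d).

Lemma in_cbox_face s t : in_cbox a b s -> face R t s -> in_cbox a b t.
Proof. by move=> sc /faceP ts k; have := sc k; have := ts k; lia. Qed.

Lemma box_lower_faces i : has_lower_faces (box R a b i) i.
Proof.
move=> s t /boxP[sc _] si st ts; apply/boxP; split; last by left; lia.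
exact: in_cbox_face st.
Qed.

Lemma dual_box_lower_faces i : has_lower_faces (dual_box R a b i) (d - i).
Proof.
move=> s t /dual_boxP[sc _] si /faceP st ts; apply/dual_boxP; split; last by lia.
by move=> k; have := sc k; have := st k; lia.
Qed.

Lemma finite_in_cbox : finite_set (in_cbox a b).
Proof.
(* The sum of the side lengths is a common bound for the offsets from [a] in all directions. *)
pose N := (\sum_(k < d) `|b 0%R k - a 0%R k|)%N.
pose F (u : {ffun 'I_d -> 'I_N.+1} * {set 'I_d}) : cell d :=
  (\row_k (a 0 k + (u.1 k : nat)%:Z), u.2).
apply: (@sub_finite_set _ _ (F @` setT)); last exact/finite_image/finite_finset.
move=> [x S] H; exists ([ffun k => inord `|(x 0 k - a 0 k)%R|%N], S) => //.
rewrite /F /=; congr (_, _); apply/rowP => k; rewrite !mxE ffunE.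
have [/= H1 H2] := H k.
have kN : (`|b 0%R k - a 0%R k| <= N)%N by rewrite /N (bigD1 k) //= leq_addr.
by rewrite inordK; lia.
Qed.

Lemma plaquettes_boxP i s : (0 < i)%N ->
  plaquettes (box R a b i) i s <-> inner a b s /\ cdim s = i.
Proof.
move=> i0; rewrite /plaquettes /= boxP; split=> [[[sc [|[_ //]]]]|[si sE]].
  by move=> h1 h2; lia.
by split=> //; split; [exact: si.1|right].
Qed.

Lemma skeleton_boxP i s :
  skeleton (box R a b i) i.-1 s <-> in_cbox a b s /\ (cdim s <= i.-1)%N.
Proof.
rewrite /skeleton /= boxP; split=> [[[]]//|[sc sE]].
by split=> //; split=> //; left.
Qed.

Lemma finite_plaquettes_box i : (0 < i)%N -> finite_set (plaquettes (box R a b i) i).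
Proof.
move=> i0; apply: sub_finite_set finite_in_cbox => s /plaquettes_boxP-[//|[] //].
Qed.

(** The face lies strictly between the two walls orthogonal to direction [k], so the unit edge on
    either side of it still fits in the box. *)
Lemma inner_coface s k : k \in s.2 ->
  inner a b (front s k) \/ inner a b (back s k) -> inner a b s.
Proof.
move=> ks H.
have [fs nfs] : in_cbox a b s /\ forall j, j \notin s.2 -> a 0 j < s.1 0 j < b 0 j; last by [].
have E j : a 0 j <= s.1 0 j /\ s.1 0 j + (j \in s.2)%:R <= b 0 j /\
    (j \notin s.2 -> a 0 j < s.1 0 j < b 0 j).
  case: H => -[H1 H2]; have := H1 j; have := H2 j; rewrite /= ?mxE !inE ?eqxx /=;
    have [->|jk] /= := eqVneq j k; rewrite ?ks ?addr0 /=.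
  - by move=> /(_ isT); lia.
  - by case: (j \in s.2) => /=; [lia|move=> /(_ isT); lia].
  - by move=> /(_ isT); lia.
  - by case: (j \in s.2) => /=; [lia|move=> /(_ isT); lia].
by split=> [j|j nj]; have [? [? ?]] := E j; auto.
Qed.

Variable i : nat.
Hypotheses (i_gt0 : (0 < i)%N) (i_lt : (i < d)%N).

Let dual_cell_inj : injective (@dual_cell d).
Proof. exact: can_inj (@dual_cellK d). Qed.

Lemma dual_plaquettesE X A :
  dual_plaquettes R X i A = @dual_cell d @` (plaquettes X i `\` A).
Proof.
apply/seteqP; split=> t.
  by move=> [s [Xs As /is_dualP->]]; exists s.
by move=> [s [Xs As] <-]; exists s; split=> //; apply/is_dualP.
Qed.

Lemma dual_image_plaquettes :
  @dual_cell d @` plaquettes (box R a b i) i = plaquettes (dual_box R a b i) (d - i).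
Proof.
apply/seteqP; split=> t.
  move=> [s /plaquettes_boxP-[//|si sE] <-]; split; last by rewrite cdim_dual sE.
  by apply/dual_box_inner; rewrite ?sE // ltnW.
move=> [tX tE]; exists (primal_cell t); last by rewrite primal_cellK.
apply/plaquettes_boxP => //; split; last by rewrite cdim_primal tE; lia.
by move: tX; rewrite -{1}[t]primal_cellK => /dual_box_inner-[|//]; rewrite ltnW.
Qed.

Lemma dual_complex_sub P :
  dual_plaquettes R (box R a b i) i P `<=` plaquettes (dual_box R a b i) (d - i).
Proof.
rewrite dual_plaquettesE -dual_image_plaquettes => _ [s [Xs _] <-].
by exists s.
Qed.

Lemma plaquettes_dual_complex P : percolation R (box R a b i) i P ->
  plaquettes (dual_complex R a b i P) (d - i) =
  @dual_cell d @` (plaquettes (box R a b i) i `\` plaquettes P i).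
Proof.
move=> hP; rewrite plaquettes_setU; [|by lia|exact: dual_complex_sub].
rewrite dual_plaquettesE; congr (_ @` _); apply/seteqP; split=> s [Xs nP]; split=> //.
  by case.
by move=> Ps; apply: nP; split=> //; case: Xs.
Qed.

(** A percolation subcomplex is determined by its plaquettes, and duality complements this set and
    carries it over by [dual_cell]. *)
Lemma dual_complex_bij :
  set_bij [set P | percolation R (box R a b i) i P]
    [set Q | percolation R (dual_box R a b i) (d - i) Q] (dual_complex R a b i).
Proof.
have di0 : (0 < d - i)%N by lia.
split.
- move=> P hP; apply: percolation_setU => //; last exact: dual_complex_sub.
  exact: dual_box_lower_faces.
- move=> P P'; rewrite !inE /= => hP hP' PP'.
  rewrite (percolation_eq i_gt0 hP) (percolation_eq i_gt0 hP'); congr (_ `|` _).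
  have := congr1 (fun Q => plaquettes Q (d - i)) PP'.
  rewrite /= !plaquettes_dual_complex // => E.
  have {}E : plaquettes (box R a b i) i `\` plaquettes P i =
         plaquettes (box R a b i) i `\` plaquettes P' i.
    by apply/funext => s; rewrite -[LHS](image_inj dual_cell_inj) E (image_inj dual_cell_inj).
  have PX := percolation_plaquettes hP; have PX' := percolation_plaquettes hP'.
  by rewrite -(setIidr PX) -(setIidr PX') -!setDD E.
- move=> Q /= hQ.
  pose A := plaquettes (box R a b i) i `\` [set s | Q (dual_cell s)].
  have AX : A `<=` plaquettes (box R a b i) i by move=> s [].
  have hP : percolation R (box R a b i) i (skeleton (box R a b i) i.-1 `|` A).
    by apply: percolation_setU => //; apply: box_lower_faces.
  exists (skeleton (box R a b i) i.-1 `|` A) => //.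
  rewrite (percolation_eq di0 hQ) /dual_complex; congr (_ `|` _).
  rewrite -(plaquettes_setU di0 (@dual_complex_sub _)) -/(dual_complex _ _ _ _ _).
  rewrite plaquettes_dual_complex // plaquettes_setU // /A setDD.
  apply/seteqP; split=> t.
    by move=> [s [sX Qs] <-]; split=> //; rewrite cdim_dual; case: sX => _ ->.
  move=> Qt; have := percolation_plaquettes hQ Qt.
  rewrite -dual_image_plaquettes => -[s sX st]; exists s => //; split=> //=.
  by rewrite st; case: Qt.
Qed.

Lemma nplaquettes_dual_complex P : percolation R (box R a b i) i P ->
  (nplaquettes P i <= nplaquettes (box R a b i) i)%N /\
  nplaquettes (dual_complex R a b i P) (d - i) =
  (nplaquettes (box R a b i) i - nplaquettes P i)%N.
Proof.
move=> hP; have fX := finite_plaquettes_box i_gt0.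
have PX := percolation_plaquettes hP; have fP := sub_finite_set PX fX.
have sub : (fset_set (plaquettes P i) `<=` fset_set (plaquettes (box R a b i) i))%fset.
  by rewrite -fset_set_sub.
split; first exact: fsubset_leq_card.
rewrite /nplaquettes plaquettes_dual_complex // card_inj_image //; last exact: finite_setD.
by rewrite fset_setD // cardfsD (fsetIidPr sub).
Qed.

Lemma nplaquettes_dual_box :
  nplaquettes (dual_box R a b i) (d - i) = nplaquettes (box R a b i) i.
Proof.
rewrite /nplaquettes -dual_image_plaquettes card_inj_image //.
exact: finite_plaquettes_box.
Qed.

End Percolation.

(** * Orders of the images in cohomology and Borel-Moore homology *)

Section Images.
Variables (R : realType) (d q n : nat) (a b : 'rV[int]_d) (xi P : set (cell d)).
Hypothesis n_lt : (n.+1 < d)%N.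
Local Notation i := n.+1.
Local Notation X := (box R a b i).
Hypothesis hP : percolation R X i P.

Local Notation K0 := (skeleton X n).
Local Notation A := (plaquettes P i).
Local Notation O0 := (xi `\` X).
Implicit Types (f g h : cell d -> 'Z_q) (s t : cell d).

Lemma add_coset_eq (B : set (cell d -> 'Z_q)) f g :
  B 0 -> (forall x y, B x -> B y -> B (x - y)) ->
  add_coset B f = add_coset B g <-> B (f - g).
Proof.
move=> B0 BB; split=> [fg|Bfg].
  have : add_coset B f f by exists 0; rewrite ?addr0.
  by rewrite fg => -[c Bc <-]; rewrite addrAC subrr add0r.
apply/seteqP; split=> _ [c Bc <-].
  exists (f - g - (0 - c)); last by rewrite sub0r opprK addrA [g + _]addrC subrK.
  by apply: (BB) => //; apply: BB.
by exists (c - (f - g)); [exact: BB|rewrite opprB addrCA [f + _]addrC subrK addrC].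
Qed.

Lemma skeleton_sub : K0 `<=` P.
Proof. by case: hP. Qed.

Lemma open_lowdim s : P s -> (cdim s <= n)%N -> K0 s.
Proof. by case: hP => _ _ PX Ps sn; split=> //; have [] := PX _ Ps. Qed.

(** Below dimension [i] every [P] coincides with [K0]; this is how the dependence on [P] disappears
    from the group of coboundaries. *)
Lemma restriction_lowdim m f : (m <= n)%N -> dim_supp m f ->
  restriction P f = restriction K0 f.
Proof.
move=> mn fm; apply/funext => s; rewrite /restriction.
have [fs|/fm sm] := eqVneq (f s) 0; first by rewrite fs !if_same.
have -> // : (s \in P) = (s \in K0).
apply/idP/idP => [/set_mem Ps|/set_mem Ks]; apply/mem_set; last exact: skeleton_sub.
by apply: open_lowdim; rewrite ?sm.
Qed.

(** The group E of the overview: the coboundaries of [P] in degree [n], written without [P]. It is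
    trivial for [n = 0], as cohomology is not reduced. *)
Definition exact_cochains : set (cell d -> 'Z_q) :=
  if n is m.+1 then [set restriction K0 (cobound f) | f in dim_supp m] else [set 0].

Lemma coboundary_open Y m f : (forall s k, Y s -> k \in s.2 -> Y (front s k) /\ Y (back s k)) ->
  dim_supp m f -> restriction Y (cobound f) = coboundary Y (restriction Y f)
  /\ chains Y m (restriction Y f).
Proof.
move=> Yf fm; split.
  apply/funext => s; rewrite coboundaryE /restriction; case: ifPn => // /set_mem Ys.
  apply: eq_bigr => k ks; have [Y1 Y2] := Yf _ _ Ys ks.
  by rewrite !mem_set.
move=> s; rewrite /restriction; case: ifPn; last by rewrite eqxx.
by move=> /set_mem Ys /fm.
Qed.

Lemma open_faces s k : P s -> k \in s.2 -> P (front s k) /\ P (back s k).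
Proof.
case: hP => sub _ _ Ps ks; split; apply: sub Ps _.
  exact: face_front.
exact: face_back.
Qed.

Lemma chains_dim Y m f : chains Y m f -> dim_supp m f.
Proof. by move=> fY s /fY []. Qed.

Lemma coboundary_restriction Y f : coboundary Y f = restriction Y (cobound f).
Proof. by apply/funext => s; rewrite coboundaryE. Qed.

Lemma coboundariesE : coboundaries P n = exact_cochains.
Proof.
rewrite /exact_cochains /=; case En : n => [|m] //=.
have mn : (m < n)%N by rewrite En.
apply/seteqP; split.
  move=> _ [f /chains_dim fm <-]; exists f => //.
  by rewrite coboundary_restriction -En -(@restriction_lowdim n) // En; apply: cobound_dim.
move=> _ [f fm <-]; have [E1 E2] := coboundary_open open_faces fm.
exists (restriction P f) => //; rewrite -E1 -En (@restriction_lowdim n) // En.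
exact: cobound_dim.
Qed.

Lemma exact_cochains0 : exact_cochains 0.
Proof.
rewrite /exact_cochains; case: n => // m; exists 0; first by move=> s; rewrite eqxx.
by apply/funext => s; rewrite cobound0 /restriction if_same.
Qed.

Lemma exact_cochainsB f g : exact_cochains f -> exact_cochains g -> exact_cochains (f - g).
Proof.
rewrite /exact_cochains; case: n => [-> ->|m]; first by rewrite subrr.
move=> [f' fm <-] [g' gm <-]; exists (f' - g'); first exact: dim_suppB.
by rewrite coboundB restrictionB.
Qed.

Lemma with_bc_plaquettes s : with_bc X i xi P s -> cdim s = i -> (A `|` O0) s.
Proof. by move=> [[Ps|Os]|[_ sn]] sE; [left|right|exfalso; move: sn; rewrite sE ltnn]. Qed.

(** The boundary condition contains the full lattice skeleton of dimension [n], so every [n]-cochain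
    of the lattice is allowed and only the open plaquettes impose conditions. *)
Lemma cocycles_with_bc :
  cocycles (with_bc X i xi P) n = cocycles_off n O0 A :> set (cell d -> 'Z_q).
Proof.
apply/seteqP; split=> f.
  move=> [fn f0]; split; first exact: chains_dim fn.
  move=> s Os; have := congr1 (fun h => h s) f0.
  rewrite coboundaryE mem_set //; left; case: Os => [[]|]; by [left|right].
move=> [fn f0]; split.
  by move=> s /fn sn; split=> //; right; split=> //=; rewrite sn.
apply/funext => s; rewrite coboundaryE; case: ifPn => // /set_mem Ys.
have [//|/(cobound_dim fn) sE] := eqVneq (cobound f s) 0.
exact/f0/with_bc_plaquettes.
Qed.

Lemma restriction_cocycles :
  restriction P @` cocycles (with_bc X i xi P) n =
  local_cocycles n K0 O0 A :> set (cell d -> 'Z_q).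
Proof.
rewrite cocycles_with_bc; apply: eq_imagel => f [fn _].
exact: restriction_lowdim fn.
Qed.

Lemma exact_cochains_sub : exact_cochains `<=` local_cocycles n K0 O0 A.
Proof.
rewrite /exact_cochains; case En : n => [|m].
  by move=> _ ->; apply: local_cocycles0.
move=> _ [f fm <-]; exists (cobound f) => //; split; first exact: cobound_dim.
by move=> s _; rewrite cobound_cobound.
Qed.

Lemma finite_K0 : finite_set K0.
Proof.
by apply: sub_finite_set (finite_in_cbox a b) => s /(@skeleton_boxP R d a b i) [].
Qed.

Lemma card_im_cohomologyE :
  #|` fset_set (local_cocycles n K0 O0 A : set (cell d -> 'Z_q))| =
  (card_im_cohomology q P (with_bc X i xi P) n * #|` fset_set exact_cochains|)%N.
Proof.
rewrite (@card_group_image _ _ _ exact_cochains (add_coset exact_cochains));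
  [|by apply: finite_local_cocycles; exact: finite_K0|exact: local_cocycles0
   |exact: local_cocyclesB|];
  last first.
  move=> f g _ _; apply: add_coset_eq; [exact: exact_cochains0|exact: exact_cochainsB].
rewrite (setIidr exact_cochains_sub); congr (_ * _)%N.
rewrite /card_im_cohomology; congr (size (fset_set _)).
rewrite /cohomology /quotient_set image_comp -restriction_cocycles image_comp.
rewrite -coboundariesE; apply: eq_imagel => z _ /=; apply/esym/induced_add_coset.
- by move=> x y; apply/funext => s; rewrite /restriction !fctE; case: ifP; rewrite ?addr0.
- rewrite coboundariesE /exact_cochains /coboundaries; case En : n => [|m].
    by move=> _ [_ -> <-]; apply/funext => s; rewrite /restriction if_same.
  move=> _ [_ [f /chains_dim fm <-] <-]; exists f => //.
  rewrite -En -(@restriction_lowdim n) // ?En; last exact: cobound_dim.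
  apply/funext => s; rewrite /restriction coboundaryE; case: ifPn => // /set_mem Ps.
  by rewrite mem_set //; left; left.
- rewrite /coboundaries; case: n => // m; exists 0; first by move=> s; rewrite eqxx.
  by apply/funext => s; rewrite coboundaryE cobound0 if_same.
- rewrite coboundariesE => x y Ex Ey; have -> : x + y = x - (0 - y) by rewrite sub0r opprK.
  by do 2 apply: exact_cochainsB => //; apply: exact_cochains0.
Qed.

Local Notation Q := (dual_complex R a b i P).
Local Notation Xd := (dual_box R a b i).
Local Notation xid := (dual_plaquettes R [set: cell d] i xi).
Local Notation Qxi := (with_bc Xd (d - i) xid Q).

(** The cycles of [Q] in dual form, whose number is the |C| of the overview. *)
Definition inner_cocycles : set (cell d -> 'Z_q) :=
  [set h | [/\ dim_supp n.+2 h, forall s, h s != 0 -> inner a b s & cobound h = 0]].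

Lemma transport_chains Y m h : (m <= d)%N ->
  chains Y (d - m) (transport h) <-> dim_supp m h /\ forall s, h s != 0 -> Y (dual_cell s).
Proof.
move=> md; split=> [hY|[hm hY] t].
  have H s : h s != 0 -> Y (dual_cell s) /\ cdim (dual_cell s) = (d - m)%N.
    by move=> hs; apply: hY; rewrite transport_eq0 dual_cellK.
  split=> s /H[//]; rewrite cdim_dual => _; have := cdim_le s; lia.
rewrite transport_eq0 => /[dup] /hm tm /hY; rewrite primal_cellK => Yt; split=> //.
by rewrite -[t]primal_cellK cdim_dual tm.
Qed.

Lemma dual_cycles : BM_cycles Q (d - i).-1 = @transport d q @` inner_cocycles.
Proof.
have di : (d - i).-1 = (d - n.+2)%N by lia.
apply/seteqP; split=> f.
  rewrite -[f]untransportK; set h := untransport f => -[].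
  rewrite di => /transport_chains -[//|hn hQ] h0; exists h => //; split=> //.
    move=> s hs; have := hQ _ hs; rewrite /dual_complex => -[[/dual_box_inner-[|//]]|].
      by rewrite ltnW.
    (* Plaquettes of [Q] have one dimension more than the chain, so they cannot carry it. *)
    move=> /(@dual_complex_sub R d a b i isT n_lt) [_]; rewrite cdim_dual (hn _ hs) => sE.
    by exfalso; lia.
  apply: (can_inj (@transportK d q)); rewrite -boundary_transport h0.
  by apply/funext => t; rewrite /transport mulr0.
move=> [h [hn hI h0] <-]; split.
  rewrite di; apply/transport_chains => //; split=> // s hs; left; split.
    by apply/dual_box_inner; [exact: ltnW|split; [exact: hI|rewrite (hn _ hs)]].
  by rewrite cdim_dual (hn _ hs); lia.
by rewrite boundary_transport h0; apply/funext => t; rewrite /transport mulr0.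
Qed.

Lemma box_inner s : cdim s = i -> (X s <-> inner a b s).
Proof.
move=> sE; split=> [Xs|si]; first by have /plaquettes_boxP-[] : plaquettes X i s by [].
by have [] : plaquettes X i s by apply/plaquettes_boxP.
Qed.

(** Inside the box duality complements [P], outside it complements [xi]. The skeleton added by
    [with_bc] stays below dimension [d - i] and contributes no plaquette. *)
Lemma dual_open_plaquettes s : cdim s = i -> (Qxi (dual_cell s) <-> ~ (A `|` O0) s).
Proof.
move=> sE; have dE : cdim (dual_cell s) = (d - i)%N by rewrite cdim_dual sE.
have ndE : ~ (cdim (dual_cell s) <= (d - i).-1)%N by rewrite dE; lia.
have inj : injective (@dual_cell d) by exact: can_inj (@dual_cellK d).
have QE : Q (dual_cell s) <-> X s /\ ~ P s.
  rewrite /dual_complex dual_plaquettesE; split.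
    by case=> [[_ /ndE]//|]; rewrite (image_inj inj) => -[[]].
  by move=> [Xs nPs]; right; rewrite (image_inj inj).
have xiE : xid (dual_cell s) <-> ~ xi s.
  rewrite dual_plaquettesE (image_inj inj); split=> [[]//|nxi].
  by split.
have XdE : Xd (dual_cell s) <-> X s.
  rewrite box_inner // dual_box_inner; last exact: ltnW.
  by rewrite sE; split=> [[]|].
split=> [[[/QE[Xs nP]|[/xiE nxi /XdE nX]]|[_ /ndE]//]|nAO].
- by case=> [[]|[]].
- by case=> [[Ps _]|[]//]; apply: nX; case: hP => _ _ PX; have [] := PX _ Ps.
- left; have [Xs|nXs] := pselect (X s).
    by left; apply/QE; split=> // Ps; apply: nAO; left.
  right; split; last by move/XdE.
  by apply/xiE => xs; apply: nAO; right.
Qed.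

Definition open_boundaries : set (cell d -> 'Z_q) :=
  [set h | exists g, [/\ dim_supp i g, forall s, (A `|` O0) s -> g s = 0 & h = cobound g]].

Lemma dual_boundaries :
  BM_boundaries Qxi (d - i).-1 = @transport d q @` open_boundaries.
Proof.
have dE : (d - i).-1.+1 = (d - i)%N by lia.
have H g : chains Qxi (d - i) (transport g) <->
    dim_supp i g /\ forall s, (A `|` O0) s -> g s = 0.
  rewrite transport_chains ?(ltnW n_lt) //; split=> -[gn H]; split=> // s.
    move=> As; have [//|/[dup] /gn sE /H] := eqVneq (g s) 0.
    by move/(dual_open_plaquettes sE).
  move=> /[dup] /gn sE gs; apply/dual_open_plaquettes => // As.
  by move: gs; rewrite H ?eqxx.
rewrite /BM_boundaries dE; apply/seteqP; split=> f.
  move=> [f']; rewrite -[f']untransportK; set g := untransport f' => /H[gn g0] <-.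
  by rewrite boundary_transport; exists (cobound g) => //; exists g.
move=> [_ [g [gn g0 ->]] <-]; exists (transport g); first exact/H.
exact: boundary_transport.
Qed.

Lemma inner_cocycles_boundaries :
  inner_cocycles `&` open_boundaries = local_coboundaries n (inner a b) O0 A.
Proof.
apply/seteqP; split=> h; first by move=> [[hn hI h0] hB].
move=> [hI [g [gn g0 hE]]]; split; last by exists g.
by split=> //; rewrite hE ?cobound_cobound //; apply: cobound_dim.
Qed.

Lemma finite_inner : finite_set (inner a b).
Proof. by apply: sub_finite_set (finite_in_cbox a b) => s []. Qed.

(** The cycles of [Q] whose class dies are those that bound in the larger complex; dually, they are
    [inner_cocycles] in [open_boundaries], that is, B(P). *)
Lemma card_im_BME :
  #|` fset_set inner_cocycles| =
  (card_im_BM q Q Qxi (d - i).-1 *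
   #|` fset_set (local_coboundaries n (inner a b) O0 A : set (cell d -> 'Z_q))|)%N.
Proof.
have fin : finite_set inner_cocycles.
  apply: (sub_finite_set _ (@finite_supported_functions _ _ (0 : 'Z_q) _ finite_inner)).
  by move=> h [].
have inj : injective (@transport d q) by exact: can_inj (@transportK d q).
rewrite -(card_inj_image inj fin) -dual_cycles.
have B0 (Y : set (cell d)) m : BM_boundaries Y m (0 : cell d -> 'Z_q).
  exists 0; first by move=> s; rewrite eqxx.
  by apply/funext => s; rewrite boundaryE big1 // => k _; rewrite subrr mulr0.
have BB (Y : set (cell d)) m (f g : cell d -> 'Z_q) :
    BM_boundaries Y m f -> BM_boundaries Y m g -> BM_boundaries Y m (f - g).
  move=> [f' fY <-] [g' gY <-]; exists (f' - g').
    move=> s; rewrite !fctE; have [->|/fY //] := eqVneq (f' s) 0.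
    by rewrite sub0r oppr_eq0 => /gY.
  apply/funext => s; rewrite !fctE !boundaryE -sumrB; apply: eq_bigr => k _.
  by rewrite -mulrBr /=; congr (_ * _); ring.
rewrite (@card_group_image _ _ _ (BM_boundaries Qxi (d - i).-1)
   (add_coset (BM_boundaries Qxi (d - i).-1))).
- congr (_ * _)%N.
    rewrite /card_im_BM /BM_homology /quotient_set image_comp.
    congr (size (fset_set _)); apply: eq_imagel => z _ /=; apply/esym/induced_add_coset => //.
      move=> _ [_ [f fQ <-] <-]; exists f => // s /fQ [Qs sE]; split=> //.
      by left; left.
    move=> x y Bx By; have -> : x + y = x - (0 - y) by rewrite sub0r opprK.
    by apply: (BB) => //; apply: (BB).
  rewrite dual_boundaries dual_cycles -inner_cocycles_boundaries.
  have -> : @transport d q @` inner_cocycles `&` @transport d q @` open_boundaries =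
      @transport d q @` (inner_cocycles `&` open_boundaries).
    apply/seteqP; split=> f; last by move=> [h [h1 h2] <-]; split; exists h.
    by move=> [[h hZ <-] [h' hB /inj hh]]; exists h => //; split=> //; rewrite -hh.
  by rewrite card_inj_image //; apply: finite_setIl.
- by rewrite dual_cycles; exact: finite_image.
- split; first by move=> s; rewrite eqxx.
  by apply/funext => s; rewrite boundaryE big1 // => k _; rewrite subrr mulr0.
- rewrite dual_cycles => _ _ [f [fn fI f0] <-] [g [gn gI g0] <-].
  rewrite -transportB; exists (f - g) => //; split; first exact: dim_suppB.
    move=> s; rewrite !fctE; have [->|/fI //] := eqVneq (f s) 0.
    by rewrite sub0r oppr_eq0 => /gI.
  by rewrite coboundB f0 g0 subrr.
- by move=> f g _ _; apply: add_coset_eq; [exact: B0|exact: BB].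
Qed.

Lemma finite_open_plaquettes : finite_set A.
Proof.
apply: (sub_finite_set _ (finite_plaquettes_box R a b (ltn0Sn n))).
exact: percolation_plaquettes hP.
Qed.

(** Both coset counts are inserted into [card_local_duality]. The comparison with [set0] leaves only
    factors common to all [P], besides the two image orders and the power of [q]. *)
Lemma card_im_duality : (1 < q)%N ->
  (card_im_cohomology q P (with_bc X i xi P) n * q ^ nplaquettes P i *
    (#|` fset_set exact_cochains| * #|` fset_set inner_cocycles|) =
   #|` fset_set (local_cocycles n K0 O0 set0 : set (cell d -> 'Z_q))| *
   #|` fset_set (local_coboundaries n (inner a b) O0 set0 : set (cell d -> 'Z_q))| *
   card_im_BM q Q Qxi (d - i).-1)%N.
Proof.
move=> q_gt1; rewrite -(@card_local_duality _ _ _ q_gt1 _ (plaquettes X i) _ _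
  finite_K0 finite_inner _ _ _ _ A finite_open_plaquettes).
- rewrite card_im_cohomologyE card_im_BME /nplaquettes.
  set x := card_im_cohomology _ _ _ _; set y := card_im_BM _ _ _ _.
  by set e := #|` _|; set r := expn _ _; set z := #|` _|; ring.
- by move=> s [].
- move=> s k /plaquettes_boxP-[//|[sc _] sE] ks.
  have fn : (cdim (front s k) <= n)%N by rewrite -ltnS -(cdim_front ks) sE.
  have bn : (cdim (back s k) <= n)%N by rewrite -ltnS -(cdim_back ks) sE.
  split; apply/(@skeleton_boxP R d a b i); split=> //; apply: in_cbox_face sc _.
    exact: (@face_front R).
  exact: (@face_back R).
- move=> s k ks H; apply: inner_coface ks _.
  by case: H => /plaquettes_boxP-[//|? _]; [left|right].
- by move=> s [Xs _] [].
- exact: percolation_plaquettes hP.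
Qed.

End Images.

(** * From image orders to equality of the measures *)

Section Weights.
Variables (R : realType) (d q n : nat) (p : R) (a b : 'rV[int]_d) (xi : set (cell d)).
Hypotheses (n_lt : (n.+1 < d)%N) (q_gt1 : (1 < q)%N) (hp : 0 <= p <= 1).
Local Notation i := n.+1.
Local Notation X := (box R a b i).
Local Notation Xd := (dual_box R a b i).
Local Notation xid := (dual_plaquettes R [set: cell d] i xi).
Local Notation D := ((1 - p) * q%:R + p).

(** Since q is at least 1, the denominator is at least (1 - p) + p = 1, also at the endpoints p = 0
    and p = 1. *)
Lemma dual_denominator_gt0 : 0 < D.
Proof.
have /andP[p0 p1] := hp; have q1 : 1 <= q%:R :> R by rewrite ler1n ltnW.
have : (1 - p) * 1 <= (1 - p) * q%:R by apply: ler_wpM2l => //; lra.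
by rewrite mulr1; lra.
Qed.

Lemma card_gt0 (V : zmodType) (U : set V) : finite_set U -> U 0 -> (0 < #|` fset_set U|)%N.
Proof.
by move=> finU U0; rewrite cardfs_gt0; apply/fset0Pn; exists 0; rewrite in_fset_set ?inE.
Qed.

Lemma weight_duality : exists2 C : R, C != 0 & forall P, percolation R X i P ->
  weight X p i (fun P' => card_im_cohomology q P' (with_bc X i xi P') i.-1) P =
  C * weight Xd (dual_param q p) (d - i)
    (fun Q' => card_im_BM q Q' (with_bc Xd (d - i) xid Q') (d - i).-1)
    (dual_complex R a b i P).
Proof.
pose K : nat := (#|` fset_set (local_cocycles n (skeleton X n) (xi `\` X) set0
    : set (cell d -> 'Z_q))| *
  #|` fset_set (local_coboundaries n (inner a b) (xi `\` X) set0
    : set (cell d -> 'Z_q))|)%N.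
pose E := #|` fset_set (exact_cochains R n a b : set (cell d -> 'Z_q))|.
pose Z := #|` fset_set (inner_cocycles n a b : set (cell d -> 'Z_q))|.
have finI := finite_inner a b; have finK := finite_K0 R n a b.
have K0 : (0 < K)%N.
  rewrite muln_gt0; apply/andP; split; apply: card_gt0.
  - exact: finite_local_cocycles.
  - exact: local_cocycles0.
  - exact: finite_local_coboundaries.
  - exact: local_coboundaries0.
have E0 : (0 < E)%N.
  apply: card_gt0; last exact: exact_cochains0.
  apply: (sub_finite_set (@exact_cochains_sub _ _ _ _ _ _ xi set0)).
  exact: finite_local_cocycles.
have Z0 : (0 < Z)%N.
  apply: card_gt0; last by split; rewrite ?cobound0 // => s; rewrite eqxx.
  apply: (sub_finite_set _ (@finite_supported_functions _ _ (0 : 'Z_q) _ finI)).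
  by move=> h [].
have D0 := dual_denominator_gt0; set m := nplaquettes X i.
have qn0 : q%:R != 0 :> R by rewrite pnatr_eq0; lia.
have [K0' E0' Z0'] : [/\ K%:R != 0 :> R, E%:R != 0 :> R & Z%:R != 0 :> R].
  by rewrite !pnatr_eq0; split; lia.
(* [D ^+ m] clears the denominators of the dual parameter and its complement. For k open plaquettes
   the dual weight carries q to the power m - k and the ratio of image orders supplies the other k
   factors, whence [q%:R ^+ m]. *)
exists (D ^+ m * K%:R / (q%:R ^+ m * (E%:R * Z%:R))).
  by rewrite !mulf_neq0 ?invr_neq0 ?mulf_neq0 ?expf_neq0 // gt_eqF.
move=> P hP; have [km kE] := nplaquettes_dual_complex (ltn0Sn n) n_lt hP.
rewrite /weight kE nplaquettes_dual_box // -/m subKn //; set k := nplaquettes P i.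
have := card_im_duality xi n_lt hP q_gt1.
set N := card_im_cohomology _ _ _ _; set M := card_im_BM _ _ _ _.
rewrite -/K -/E -/Z -/k; clearbody K E Z => /(congr1 (fun x : nat => x%:R : R)).
rewrite !natrM natrX => NM.
have -> : N%:R = K%:R * M%:R / (q%:R ^+ k * (E%:R * Z%:R)) :> R.
  by rewrite -NM -mulrA mulfK // !mulf_neq0 ?expf_neq0.
have -> : 1 - dual_param q p = p / D.
  by rewrite /dual_param; field; rewrite gt_eqF.
have -> : m = (k + (m - k))%N by rewrite subnKC.
rewrite addKn /dual_param !expr_div_n exprMn !exprD.
have Dk : D ^+ k != 0 by rewrite expf_neq0 // gt_eqF.
have Dl : D ^+ (m - k) != 0 by rewrite expf_neq0 // gt_eqF.
have qk : q%:R ^+ k != 0 :> R by rewrite expf_neq0.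
have ql : q%:R ^+ (m - k) != 0 :> R by rewrite expf_neq0.
(* The powers are generalized so that [field] treats them as atoms. *)
move: Dk Dl qk ql E0' Z0'; move: (D ^+ k) (D ^+ (m - k)) (q%:R ^+ k) (q%:R ^+ (m - k)).
move: (p ^+ k) ((1 - p) ^+ (m - k)) K%:R M%:R E%:R Z%:R => *.
by field; do ?[apply/andP; split].
Qed.

(** The constant of [weight_duality] is the same for all [P]; reindexing the normalizing sum along
    [dual_complex_bij] lets it cancel. *)
Lemma mu_duality P : percolation R X i P ->
  mu xi X p q i P = mu_wired xid Xd (dual_param q p) q (d - i) (dual_complex R a b i P).
Proof.
move=> hP; have [C C0 H] := weight_duality.
rewrite /mu /mu_wired /normalized H //.
rewrite (reindex_fsbig (dual_complex R a b i) _ _ _ (dual_complex_bij _ _ _ (ltn0Sn n) n_lt)).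
under [in LHS]eq_fsbigr => P' /set_mem hP' do rewrite H //.
by rewrite -mulr_fsumr invfM mulrACA divff // mul1r.
Qed.

End Weights.

Theorem theorem15 (R : realType) (d i q : nat) (p : R)
    (hd : (2 <= d)%N) (hi : (1 <= i <= d - 1)%N) (hq : (2 <= q)%N)
    (hp : 0 <= p <= 1)
    (a b : 'rV[int]_d) (hab : forall k, a 0 k < b 0 k)
    (xi : set (cell d)) (hxi : xi `<=` plaquettes [set: cell d] i)
    (P : set (cell d)) (hP : percolation R (box R a b i) i P) :
  mu xi (box R a b i) p q i P =
  mu_wired (dual_plaquettes R [set: cell d] i xi) (dual_box R a b i)
    (dual_param q p) q (d - i) (dual_complex R a b i P).
Proof.
case: i hi hxi hP => // n hi _ hP.
by apply: mu_duality => //; lia.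
Qed.
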